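(* Let $(S_n)_{n\ge 0}$ be a tampered memory elephant random walk (TMERW) with parameters $p,\lambda\in[0,1]$ and memory sets $\mathcal{D}=(D_n)_{n\ge1}$ (not necessarily nested). Suppose that $\frac{|D_n|}{n}\to 0$ almost surely as $n\to\infty$. Then the following hold. (i) If $0\le p<\frac34$ and $\frac{|D_n|}{\sqrt n}\to 0$ in $L^2$, then $$\frac{S_n}{\sqrt n}\stackrel{d}{\longrightarrow} N\left(0,\frac{1}{3-4p}\right).$$ (ii) If $p=\frac34$ and $|D_n|=\mathcal{O}(n^{\gamma})$ almost surely for some $0\le\gamma<\frac12$, then $$\frac{S_n}{\sqrt{n\log n}}\stackrel{d}{\longrightarrow}N(0,1).$$ (iii) If $\frac34<p<1$ and $|D_n|=\mathcal{O}(n^{\gamma})$ almost surely for some $0\le\gamma<2p-1$, then there exists a random variable $L$ such that $$\frac{S_n}{n^{2p-1}}\longrightarrow L\quad\text{almost surely.}$$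
   Context: TMERW: Fix $p,\lambda\in[0,1]$. Let $\mathcal{D}=(D_n)_{n\ge1}$ be a sequence of (deterministic or random) sets with $D_n\subseteq\{1,\dots,n\}$, and let $D_n^c=\{1,\dots,n\}\setminus D_n$; $|D_n|$ denotes cardinality. Let $X_1$ be a random variable with values in $\{-1,+1\}$ (arbitrary law); let $(Y_n)_{n\ge2}$ be i.i.d. with $P(Y_n=1)=1-P(Y_n=-1)=\lambda$ (the innovations); let $(\varepsilon_n)_{n\ge2}$ be i.i.d. with $P(\varepsilon_n=1)=1-P(\varepsilon_n=-1)=p$; let $(I_{n+1})_{n\ge1}$ be independent with $I_{n+1}$ uniform on $\{1,\dots,n\}$. The objects $X_1$, $\mathcal{D}$, $(Y_n)$, $(\varepsilon_n)$, $(I_n)$ are mutually independent. For $n\ge1$ define recursively $X_{n+1}=\varepsilon_{n+1}X_{I_{n+1}}$ if $I_{n+1}\notin D_n$, and $X_{n+1}=Y_{n+1}$ if $I_{n+1}\in D_n$. The TMERW is $S_0=0$, $S_n=X_1+\dots+X_n$. *)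

(* Defs.v *)
From HB Require Import structures.
From mathcomp Require Import all_boot all_order all_algebra finmap.
From mathcomp Require Import all_classical all_reals all_analysis.
From mathcomp Require Import measurable_realfun.

Set Implicit Arguments.
Unset Strict Implicit.
Unset Printing Implicit Defensive.

Import Order.TTheory GRing.Theory Num.Theory.
Import numFieldNormedType.Exports.

Local Open Scope classical_set_scope.
Local Open Scope ring_scope.

(* Mutual independence of the classes of events F i, for i in A: the product
   rule holds for every finite subfamily. *)
Definition mutually_independent d (T : measurableType d) (R : realType)
    (P : probability T R) (I : choiceType) (A : set I)
    (F : I -> set (set T)) : Prop :=
  forall (J : {fset I}) (E : I -> set T),
    (forall i, i \in J -> A i /\ F i (E i)) ->
    P (\bigcap_(i in [set` J]) E i) = (\prod_(i <- J) P (E i))%E.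

Definition sigma_rv (T : Type) d' (T' : measurableType d') (f : T -> T') :
    set (set T) :=
  preimage_set_system setT f measurable.

Definition sigma_process (T : Type) d' (T' : measurableType d') (A : set nat)
    (f : nat -> T -> T') : set (set T) :=
  <<s \bigcup_(n in A) sigma_rv (f n) >>.

(* The sigma-algebra of a sequence of random finite sets of naturals; {fset nat}
   being countable with finite elements, it is generated by the membership
   events. *)
Definition sigma_fsets (T : Type) (A : set nat)
    (D : nat -> T -> {fset nat}) : set (set T) :=
  <<s [set E | exists n k : nat, A n /\ E = [set w | k \in D n w]] >>.

Definition cvg_in_law d (T : measurableType d) (R : realType)
    (P : probability T R) (U : nat -> {RV P >-> R})
    (mu : probability (measurableTypeR R) R) : Prop :=
  forall x : R, {for x, continuous (fun r : R => mu [set` `]-oo, r]])} ->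
    cdf (U n) x @[n --> \oo] --> mu [set` `]-oo, x]].

Arguments cvg_in_law {d T R} P U mu.

(* The indices that carry meaning are n >= 1 for X and D, and n >= 2 for Y, eps
   and I; the other terms of these sequences are unconstrained and unused. *)
Record TMERW d (T : measurableType d) (R : realType) (P : probability T R)
    (p lambda : R) (D : nat -> T -> {fset nat})
    (X Y eps : nat -> {RV P >-> R}) (I : nat -> {RV P >-> nat}) : Prop := {
  tmerw_D_sub : forall n w k, (1 <= n)%N -> k \in D n w -> (1 <= k <= n)%N;
  tmerw_D_meas : forall n k, (1 <= n)%N -> measurable [set w | k \in D n w];
  tmerw_X1 : forall w, X 1%N w = 1 \/ X 1%N w = -1;
  tmerw_Y_law : forall n, (2 <= n)%N ->
    P (Y n @^-1` [set 1]) = lambda%:E /\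
    P (Y n @^-1` [set -1]) = (1 - lambda)%:E;
  tmerw_Y_indep :
    mutually_independent P [set n | (2 <= n)%N] (fun n => sigma_rv (Y n));
  tmerw_eps_law : forall n, (2 <= n)%N ->
    P (eps n @^-1` [set 1]) = p%:E /\
    P (eps n @^-1` [set -1]) = (1 - p)%:E;
  tmerw_eps_indep :
    mutually_independent P [set n | (2 <= n)%N] (fun n => sigma_rv (eps n));
  tmerw_I_range : forall n w, (1 <= n)%N -> (1 <= I n.+1 w <= n)%N;
  tmerw_I_law : forall n k, (1 <= k <= n)%N ->
    P (I n.+1 @^-1` [set k]) = (n%:R^-1)%:E;
  tmerw_I_indep :
    mutually_independent P [set n | (2 <= n)%N] (fun n => sigma_rv (I n));
  tmerw_indep :
    mutually_independent P [set: 'I_5]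
      (tnth [tuple sigma_rv (X 1%N);
                   sigma_fsets [set n | (1 <= n)%N] D;
                   sigma_process [set n | (2 <= n)%N] (fun n => Y n : T -> R);
                   sigma_process [set n | (2 <= n)%N] (fun n => eps n : T -> R);
                   sigma_process [set n | (2 <= n)%N] (fun n => I n : T -> nat)]);
  tmerw_step : forall n w, (1 <= n)%N ->
    X n.+1 w = if I n.+1 w \notin D n w then eps n.+1 w * X (I n.+1 w) w
               else Y n.+1 w
}.

Arguments TMERW {d T R} P p lambda D X Y eps I.

Definition walk d (T : measurableType d) (R : realType) (P : probability T R)
    (X : nat -> {RV P >-> R}) (n : nat) : {RV P >-> R} :=
  (\sum_(1 <= k < n.+1) (X k : {mfun T >-> R}) : {mfun T >-> R}).

(* Main.v *)
(* With a = 2 p - 1, the conditional mean of X_(n+1) given the past is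
   a S_n / n up to an error of order |D_n| / n, so n^(-a) S_n = M_n + E_n where
   M is a martingale with increments bounded by 2 (n+1)^(-a) and E_n is bounded
   by a weighted sum of the 1 + |D_j|.

   For a <= 1/2, Lindeberg's replacement argument uses Gaussian distribution
   functions as test functions: if G is the distribution function of a centered
   normal law, (q, t) |-> G (q / sqrt t) solves the heat equation, so replacing a
   martingale increment by a Gaussian one of the same variance costs only third
   order terms and terms which vanish because S_n / n tends to 0. Letting the
   initial variance t tend to 0 recovers the indicators, and this yields the
   convergence of distribution functions without characteristic functions.

   For a > 1/2, the sum of the squares of the weights converges, and Kolmogorov's
   maximal inequality gives the almost sure convergence of M. All conditioning is
   on random variables with finitely many values, so that no general theory of
   conditional expectations is involved. *)
Require Import Defs.
From HB Require Import structures.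
From mathcomp Require Import all_boot all_order all_algebra finmap.
From mathcomp Require Import all_classical all_reals all_analysis.
From mathcomp Require Import measurable_realfun.
From mathcomp Require Import ring lra zify.

Set Implicit Arguments.
Unset Strict Implicit.
Unset Printing Implicit Defensive.

Import Order.TTheory GRing.Theory Num.Theory.
Import numFieldNormedType.Exports.

Local Open Scope classical_set_scope.
Local Open Scope ring_scope.

(** * Gaussian distribution functions and the heat equation *)

(** The replacement errors carry the factors [t^(-3/2)], [t^(-2)] and [t^(-1)] in the smoothing
    variance [t], which is why [n] goes to infinity for a fixed initial variance before that
    variance shrinks. As [X^2 = 1], the conditional variance of a martingale difference misses 1
    exactly by the square of the conditional mean. This deficit is handled by the recursion for
    [E S_n^2], whose growth factor is at most [1 + 1/n] as long as [2 a <= 1]. The remainder depends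
    on the past; since the test functions are bounded and Lipschitz, it only has to be controlled
    through the mean of its truncation at 1, which suits both an L^2 and an almost sure hypothesis
    on [|D_n|]. The sets [D_n] are random and not nested, so [D_1, ..., D_n] are counted in the past
    at time [n]. Moreover [Y] and [eps] equal 1 or -1 only almost surely: the past records just
    whether they equal 1, and the walk is rebuilt from that record, up to a null set. *)

Section Taylor.
Context {R : realType}.
Implicit Types f df : R -> R.

Lemma is_derive_within_continuous f df (a b : R) :
  (forall x, a <= x <= b -> is_derive x 1 f (df x)) ->
  {within `[a, b], continuous f}.
Proof.
move=> dfE; apply: derivable_within_continuous => x.
by rewrite in_itv/= => /dfE dfx; exact: ex_derive.
Qed.

Lemma mvt_le f df (a b K : R) : a <= b ->
  (forall x, a <= x <= b -> is_derive x 1 f (df x)) ->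
  (forall x, a <= x <= b -> `|df x| <= K) ->
  `|f b - f a| <= K * (b - a).
Proof.
move=> ab dfE dfK.
have dfE' x : x \in `]a, b[ -> is_derive x 1 f (df x).
  by rewrite in_itv/= => /andP[/ltW ax /ltW xb]; apply: dfE; rewrite ax.
have [c + ->] := MVT_segment ab dfE' (is_derive_within_continuous dfE).
rewrite in_itv/= => /dfK cK.
by rewrite normrM (ger0_norm (_ : 0 <= b - a)) ?subr_ge0// ler_wpM2r// subr_ge0.
Qed.

Lemma mvt0_le f df (h K : R) :
  (forall x : R, is_derive x 1 f (df x)) ->
  (forall x, `|x| <= `|h| -> `|df x| <= K) ->
  `|f h - f 0| <= K * `|h|.
Proof.
move=> dfE dfK; have [h0|h0] := leP 0 h.
  rewrite (ger0_norm h0) -[in leRHS](subr0 h).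
  apply: (@mvt_le f df) => // x /andP[x0 xh].
  by apply: dfK; rewrite !ger0_norm.
rewrite distrC (ltr0_norm h0) -[- h]sub0r.
apply: (@mvt_le f df _ _ _ (ltW h0)) => // x /andP[x0 xh].
by apply: dfK; rewrite !ler0_norm ?lerN2// ltW.
Qed.

(** Three nested uses of the mean value inequality, each for the remainder of the next lower order.
    They give [K] instead of [K / 6]; only the order in [h] matters. *)
Lemma taylor2_le (f f1 f2 f3 : R -> R) (h K : R) :
  (forall x : R, is_derive x 1 f (f1 x)) ->
  (forall x : R, is_derive x 1 f1 (f2 x)) ->
  (forall x : R, is_derive x 1 f2 (f3 x)) ->
  (forall x, `|f3 x| <= K) ->
  `|f h - f 0 - h * f1 0 - h ^+ 2 / 2 * f2 0| <= K * `|h| ^+ 3.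
Proof.
move=> df df1 df2 f3K.
have K0 : 0 <= K by apply: le_trans (f3K 0).
have e2 x : `|f2 x - f2 0| <= K * `|x| by apply: mvt0_le.
pose g1 x := f1 x - f1 0 - x * f2 0.
have dg1 (x : R) : is_derive x 1 g1 (f2 x - f2 0).
  by apply: is_derive_eq; rewrite subr0 scaler0 add0r /GRing.scale/= mulr1.
have e1 x : `|g1 x| <= K * `|x| * `|x|.
  have -> : g1 x = g1 x - g1 0 by rewrite /g1 subrr mul0r !subr0.
  apply: mvt0_le => // y yx; apply: (le_trans (e2 _)).
  by rewrite ler_wpM2l.
pose g x := f x - f 0 - x * f1 0 - x ^+ 2 / 2 * f2 0.
have dg (x : R) : is_derive x 1 g (g1 x).
  apply: is_derive_eq; rewrite /g1 subr0 !scaler0 !add0r /GRing.scale/=.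
  by field.
have -> : f h - f 0 - h * f1 0 - h ^+ 2 / 2 * f2 0 = g h - g 0.
  by rewrite /g subrr !mul0r expr0n/= !mul0r !subr0.
rewrite exprS expr2 !mulrA -(mulrA K).
apply: mvt0_le => // y yh; apply: (le_trans (e1 _)).
by rewrite -mulrA ler_wpM2l// ler_pM.
Qed.

End Taylor.

(** * Expansions of Gaussian distribution functions in space and in variance *)

Section HeatStep.
Context {R : realType}.
Variables (k : R) (G : R -> R).
Hypothesis k0 : 0 <= k.

Definition gauss_density (z : R) := k * expR (- (z ^+ 2 / 2)).
Local Notation phi := gauss_density.
Hypothesis dG : forall x : R, is_derive x 1 G (phi x).

Lemma gauss_density_ge0 z : 0 <= phi z.
Proof. by rewrite mulr_ge0// expR_ge0. Qed.

Lemma is_derive_gauss_density (z : R) : is_derive z 1 phi (- (z * phi z)).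
Proof. by apply: is_derive_eq; rewrite /GRing.scale/= /phi; field. Qed.

Lemma gauss_density_le z : phi z <= k.
Proof.
rewrite ler_piMr// -[leRHS]expR0 ler_expR oppr_le0.
by rewrite mulr_ge0// sqr_ge0.
Qed.

Lemma sqr_gauss_density_le z : z ^+ 2 * phi z <= 2 * k.
Proof.
rewrite /phi mulrCA mulrC ler_wpM2r// expRN ler_pdivrMr ?expR_gt0//.
have := expR_ge1Dx (z ^+ 2 / 2); have := sqr_ge0 z; lra.
Qed.

Lemma exp4_gauss_density_le z : z ^+ 4 * phi z <= 16 * k.
Proof.
rewrite /phi mulrCA mulrC ler_wpM2r// expRN ler_pdivrMr ?expR_gt0//.
(* Two equal exponential factors, each at least [z^2 / 4], give a product that dominates
   [z^4 / 16]. *)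
have -> : z ^+ 2 / 2 = z ^+ 2 / 4 + z ^+ 2 / 4 by field.
rewrite expRD; have := expR_ge1Dx (z ^+ 2 / 4); have := sqr_ge0 z.
rewrite (_ : z ^+ 4 = z ^+ 2 * z ^+ 2); last by ring.
move: (z ^+ 2) (expR _) => y e y0 ye.
have : (y / 4) * (y / 4) <= e * e by apply: ler_pM; lra.
lra.
Qed.

Lemma abs_gauss_density_le z : `|z * phi z| <= 2 * k.
Proof.
have p0 := gauss_density_ge0 z; rewrite normrM (ger0_norm p0).
have : `|z| <= (1 + z ^+ 2) / 2.
  by rewrite -(real_normK (num_real z)); have := sqr_ge0 (`|z| - 1); lra.
move=> /(ler_wpM2r p0) /le_trans; apply.
have := gauss_density_le z; have := sqr_gauss_density_le z; nra.
Qed.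

Lemma exp3_gauss_density_le z : `|z ^+ 3 * phi z| <= 9 * k.
Proof.
have p0 := gauss_density_ge0 z; rewrite normrM (ger0_norm p0).
have : `|z ^+ 3| <= (z ^+ 2 + z ^+ 4) / 2.
  rewrite normrX (_ : z ^+ 4 = (z ^+ 2) ^+ 2); last by ring.
  by rewrite -(real_normK (num_real z)); have := sqr_ge0 (`|z| * (`|z| - 1)); lra.
move=> /(ler_wpM2r p0) /le_trans; apply.
have := exp4_gauss_density_le z; have := sqr_gauss_density_le z; nra.
Qed.

(** The third derivative in [h] is [(phi - z^2 phi) / s^3] with [z = (q - h) / s], hence at most
    [(k + 2 k) / s^3] in absolute value. *)
Lemma gauss_cdf_taylor (q s h : R) : 0 < s ->
  `|G ((q - h) / s) - G (q / s) + h * (phi (q / s) / s)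
    + h ^+ 2 / 2 * (q / s * phi (q / s) / s ^+ 2)| <= 3 * k / s ^+ 3 * `|h| ^+ 3.
Proof.
move=> s0; have sn0 : s != 0 by rewrite gt_eqF.
pose z (t : R) := (q - t) / s.
have dz (t : R) : is_derive t 1 z (- s^-1).
  by apply: is_derive_eq; rewrite /GRing.scale/=; field.
have dphi t := is_derive_gauss_density (z t).
pose f1 t := - (phi (z t) / s).
pose f2 t := - (z t * phi (z t) / s ^+ 2).
pose f3 t := (phi (z t) - z t ^+ 2 * phi (z t)) / s ^+ 3.
have df (t : R) : is_derive t 1 (G \o z) (f1 t).
  by apply: is_derive_eq (is_derive1_comp (dG (z t)) (dz t)) _; rewrite mulrN.
have df1 (t : R) : is_derive t 1 f1 (f2 t).
  have -> : f1 = (fun t => (phi \o z) t * (- s^-1)).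
    by apply/funext => x; rewrite /f1/= mulrN.
  have dphiz : is_derive t 1 (phi \o z) _ := is_derive1_comp (dphi t) (dz t).
  by apply: is_derive_eq; rewrite /f2/GRing.scale/=; field.
have df2 (t : R) : is_derive t 1 f2 (f3 t).
  have -> : f2 = (fun t => z t * (phi \o z) t * (- (s ^+ 2)^-1)).
    by apply/funext => x; rewrite /f2/= mulrN.
  have dphiz : is_derive t 1 (phi \o z) _ := is_derive1_comp (dphi t) (dz t).
  by apply: is_derive_eq; rewrite /f3/GRing.scale/=; field.
have f3K t : `|f3 t| <= 3 * k / s ^+ 3.
  have si : 0 <= (s ^+ 3)^-1 by rewrite invr_ge0 exprn_ge0// ltW.
  rewrite normrM (ger0_norm si) ler_wpM2r//.
  apply: (le_trans (ler_normB _ _)).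
  rewrite (ger0_norm (gauss_density_ge0 _)) ger0_norm; last first.
    by rewrite mulr_ge0 ?sqr_ge0// gauss_density_ge0.
  have := gauss_density_le (z t); have := sqr_gauss_density_le (z t); lra.
have := taylor2_le h df df1 df2 f3K.
by rewrite /f1 /f2 /z /= subr0 !mulrN !opprK.
Qed.

(** Since [x^(-1/2)] is differentiable only for [x > 0], the nested mean value argument is run on
    [[t, t + s]] instead of calling [taylor2_le]. *)
Lemma gauss_cdf_variance_taylor (q t s : R) : 0 < t -> 0 <= s ->
  `|G (q / Num.sqrt (t + s)) - G (q / Num.sqrt t)
    + s / 2 * (q / Num.sqrt t * phi (q / Num.sqrt t) / t)|
    <= 9 * k / t ^+ 2 * s ^+ 2.
Proof.
(* [w x] is [x^(-1/2)], in a form whose derivative follows from those of [expR] and [ln]. *)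
move=> t0 s0; pose w (x : R) := expR (- (ln x / 2)).
have wE x : 0 < x -> w x = (Num.sqrt x)^-1.
  by move=> x0; rewrite /w -powR12_sqrt ?ltW// /powR gt_eqF// expRN mulrC.
pose z x := q * w x.
have dz (x : R) : 0 < x -> is_derive x 1 z (- (z x / (2 * x))).
  move=> x0; have dln := is_derive1_ln x0.
  by apply: is_derive_eq; rewrite /z /w /GRing.scale/=; field; rewrite gt_eqF.
have dphi x := is_derive_gauss_density (z x).
pose g1 x := - (z x * phi (z x) / x) / 2.
pose g2 x := (3 / 4 * (z x * phi (z x)) - 4^-1 * (z x ^+ 3 * phi (z x))) / x ^+ 2.
have dg (x : R) : 0 < x -> is_derive x 1 (G \o z) (g1 x).
  move=> x0; apply: is_derive_eq (is_derive1_comp (dG (z x)) (dz x x0)) _.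
  by rewrite /g1; field; rewrite gt_eqF.
have dg1 (x : R) : 0 < x -> is_derive x 1 g1 (g2 x).
  move=> x0; have := dz x x0 => dzx; have xn0 : x != 0 by rewrite gt_eqF.
  have dphiz : is_derive x 1 (phi \o z) _ := is_derive1_comp (dphi x) (dz x x0).
  have -> : g1 = (fun x => z x * (phi \o z) x * x^-1 * (- 2^-1)).
    by apply/funext => y; rewrite /g1/= mulrN mulNr.
  have dinv : is_derive x (1 : R) (fun x : R => x^-1) (- (x ^- 2)).
    by apply: is_derive_eq (is_deriveV _ _) _ => //; rewrite /GRing.scale/= mulr1.
  by apply: is_derive_eq; rewrite /g2/GRing.scale/=; field.
have g2K x : t <= x -> `|g2 x| <= 9 * k / t ^+ 2.
  move=> tx; have x0 := lt_le_trans t0 tx.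
  rewrite normrM ler_pM//.
    have := abs_gauss_density_le (z x); have := exp3_gauss_density_le (z x).
    by rewrite !ler_norml => /andP[? ?] /andP[? ?]; lra.
  have xi : 0 <= x ^- 2 by rewrite invr_ge0 sqr_ge0.
  by rewrite (ger0_norm xi) lef_pV2 ?posrE ?exprn_gt0// lerXn2r// nnegrE ltW.
have e1 x : t <= x -> `|g1 x - g1 t| <= 9 * k / t ^+ 2 * (x - t).
  move=> tx; apply: (@mvt_le _ g1 g2 _ _ _ tx) => y /andP[ty _].
    by apply: dg1; exact: lt_le_trans ty.
  exact: g2K.
(* Without its first-order term, the function has derivative [g1 x - g1 t], of order [s]; the
   remainder is then of order [s^2]. *)
pose F x := (G \o z) x - (x - t) * g1 t.
have dF (x : R) : 0 < x -> is_derive x 1 F (g1 x - g1 t).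
  move=> x0; have := dg x x0 => dgx.
  by apply: is_derive_eq; rewrite subr0 scaler0 add0r /GRing.scale/= mulr1.
have : `|F (t + s) - F t| <= 9 * k / t ^+ 2 * s * (t + s - t).
  have ts : t <= t + s by rewrite lerDl.
  apply: (@mvt_le _ F (fun x => g1 x - g1 t) _ _ _ ts).
    by move=> x /andP[tx _]; apply: dF; exact: lt_le_trans tx.
  move=> x /andP[tx xs]; apply: le_trans (e1 x tx) _; apply: ler_wpM2l; last lra.
  by rewrite divr_ge0 ?sqr_ge0// mulr_ge0.
rewrite /F /g1 /z /= !wE//; last by lra.
have -> : t + s - t = s by ring.
move=> H; rewrite (expr2 s) (mulrA _ s s); apply: le_trans H.
rewrite le_eqVlt; apply/orP; left; apply/eqP; congr (`| _ |).
move: (_ / _ * phi _) (G (q / Num.sqrt t)) (G (q / Num.sqrt (t + s))) => A B C.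
by ring.
Qed.

(* [(q, t) |-> G (q / sqrt t)] solves the heat equation, so replacing a step of
   variance [b ^+ 2] by an increase of the variance [t] costs only the terms
   that vanish for a normalized martingale difference [xi]. *)
Lemma gauss_cdf_heat_step (q t b xi : R) : 0 < t -> 0 <= b -> `|xi| <= 2 ->
  `|G ((q - b * xi) / Num.sqrt t) - G (q / Num.sqrt (t + b ^+ 2))
    + b * (xi * (phi (q / Num.sqrt t) / Num.sqrt t))
    + b ^+ 2 / 2 * ((xi ^+ 2 - 1) * (q / Num.sqrt t * phi (q / Num.sqrt t) / t))|
  <= 24 * k / Num.sqrt t ^+ 3 * b ^+ 3 + 9 * k / t ^+ 2 * b ^+ 4.
Proof.
move=> t0 b0 xi2; have s0 : 0 < Num.sqrt t by rewrite sqrtr_gt0.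
have := gauss_cdf_taylor q (b * xi) s0.
have := gauss_cdf_variance_taylor q t0 (sqr_ge0 b).
rewrite sqr_sqrtr ?(ltW t0)// normrM (ger0_norm b0).
move: (phi _ / _) (_ / _ * phi _ / _) => A B.
move: (G (q / Num.sqrt t)) (G (q / Num.sqrt (t + b ^+ 2)))
  (G ((q - b * xi) / Num.sqrt t)) => g2 g1 g3 h1 h2.
have -> : g3 - g1 + b * (xi * A) + b ^+ 2 / 2 * ((xi ^+ 2 - 1) * B) =
  (g3 - g2 + b * xi * A + (b * xi) ^+ 2 / 2 * B) - (g1 - g2 + b ^+ 2 / 2 * B).
  by field.
apply: le_trans (ler_normB _ _) _; apply: lerD; last first.
  by apply: le_trans h1 _; rewrite -exprM.
apply: le_trans h2 _.
have -> : 24 * k / Num.sqrt t ^+ 3 * b ^+ 3 =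
  3 * k / Num.sqrt t ^+ 3 * (b * 2) ^+ 3 by field; rewrite gt_eqF.
apply: ler_wpM2l; first by rewrite divr_ge0 ?exprn_ge0 ?mulr_ge0// ltW.
by rewrite lerXn2r ?nnegrE ?mulr_ge0 ?ler_wpM2l.
Qed.

End HeatStep.

(** * The normal distribution function *)

Section NormalCdf.
Context {R : realType}.
Variable s : R.
Hypothesis s0 : 0 < s.
Local Notation mu := (@lebesgue_measure R).

(** The standard normal distribution function, whatever [s > 0]. Rescaling N(0, s^2) makes the
    target law appear without a change of variables in the integral. *)
Definition normal_cdf (y : R) : R :=
  fine (normal_prob 0 s [set` `]-oo, s * y]]).

Lemma normal_cdf_ge0 y : 0 <= normal_cdf y.
Proof. by apply: fine_ge0; exact: measure_ge0. Qed.

Lemma normal_cdfE x : normal_prob 0 s [set` `]-oo, x]] = (normal_cdf (x / s))%:E.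
Proof.
rewrite /normal_cdf mulrC divfK ?gt_eqF// fineK//.
exact: fin_num_measure.
Qed.

Lemma normal_cdf_le1 y : normal_cdf y <= 1.
Proof.
rewrite -lee_fin -[(normal_cdf y)%:E]fineK//= /normal_cdf fineK; last exact: fin_num_measure.
exact: probability_le1.
Qed.

Lemma normal_cdf_tails (e : R) : 0 < e ->
  exists K : R, [/\ 0 < K, 1 - e <= normal_cdf K & normal_cdf (- K) <= e].
Proof.
move=> e0.
pose N : probability (measurableTypeR R) R := normal_prob 0 s.
have mid : measurable_fun setT (idfun : measurableTypeR R -> R) by exact: measurable_id.
(* The identity has law [N] under [N], so the limits of a [cdf] at both infinities apply. *)
pose X : {RV N >-> R} := HB.pack (idfun : measurableTypeR R -> R)
  (isMeasurableFun.Build _ _ _ _ _ mid).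
have cE x : fine (cdf X x) = normal_cdf (x / s).
  by rewrite /normal_cdf [s * _]mulrC divfK ?gt_eqF.
have /fine_cvg/cvgrPdist_le/(_ _ e0) hy := cvg_cdfy1 X.
have := cvg_cdfNy0 X; rewrite cvgNy_compNP => /fine_cvg/cvgrPdist_le/(_ _ e0) hN.
have [K [[K0 h1] h2]] : exists K : R, (0 < K /\ `|1 - (fine \o cdf X) K| <= e) /\
    `|0 - (fine \o (cdf X \o -%R)) K| <= e.
  apply: (@filter_ex _ (pinfty_nbhs R)); apply: filterI hN.
  by apply: filterI hy; exact: nbhs_pinfty_gt.
exists (K / s); split; first by rewrite divr_gt0.
  by move: h1; rewrite /= cE ler_norml => /andP[_]; lra.
by move: h2; rewrite /= cE mulNr ler_norml => /andP[]; lra.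
Qed.

Lemma is_derive_normal_cdf (y : R) :
  is_derive y 1 normal_cdf (gauss_density (s * normal_peak s) y).
Proof.
pose F x := (\int[mu]_(t in [set` `]-oo, x]]) (normal_pdf 0 s t))%R.
have dF (x : R) : is_derive x 1 F (normal_pdf 0 s x).
  have ip : mu.-integrable [set` `]-oo, x + 1]] (EFin \o normal_pdf 0 s).
    exact: integrableS (integrable_normal_pdf 0 s).
  have cp : {for x, continuous (normal_pdf 0 s)}.
    by apply: continuous_normal_pdf; rewrite gt_eqF.
  have xx1 : x < x + 1 by rewrite ltrDl.
  have [dF F'] := continuous_FTC1 xx1 ip (ltNyr _) cp.
  apply: DeriveDef; first exact: dF.
  by rewrite -F' derive1E.
have -> : normal_cdf = F \o (fun y => s * y) by [].
have dm : is_derive y (1 : R) (fun y => s * y) s.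
  by apply: is_derive_eq; rewrite /GRing.scale/= mulr1.
apply: is_derive_eq (is_derive1_comp (dF _) dm) _.
rewrite normal_pdfE ?gt_eqF// /gauss_density /normal_fun subr0 [_ * s]mulrC mulrA.
by congr (_ * expR _); field; rewrite gt_eqF.
Qed.

End NormalCdf.

(** * Weighted averages and sums of powers *)

Section Sums.
Context {R : realType}.
Implicit Types (w c x W : nat -> R) (a s : R).

Lemma ler_sum_nat_widen w m n : (forall j, (1 <= j)%N -> 0 <= w j) ->
  (m <= n)%N -> \sum_(1 <= j < m) w j <= \sum_(1 <= j < n) w j.
Proof.
move=> w0; elim: n => [|n IH]; first by rewrite leqn0 => /eqP ->.
rewrite leq_eqVlt => /predU1P[->//|]; rewrite ltnS => /IH /le_trans; apply.
case: n {IH} => [|n]; first by rewrite !big_geq.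
by rewrite [leRHS]big_nat_recr//= lerDl w0.
Qed.

(** Replaces cutting a sum at [N]: in [toeplitz_null] it is applied to [|w j * c j| - h * w j],
    which is nonpositive once [|c j| <= h]. *)
Lemma sum_nat_ub w N : (forall j, (N <= j)%N -> w j <= 0) ->
  exists K, forall n, \sum_(1 <= j < n) w j <= K.
Proof.
move=> wN; exists (\sum_(1 <= j < N) `|w j|) => n.
apply: (@le_trans _ _ (\sum_(1 <= j < minn n N) `|w j|)); last first.
  by apply: ler_sum_nat_widen => //; exact: geq_minr.
elim: n => [|n IH]; first by rewrite min0n !big_geq.
case: n IH => [|n] IH; first by rewrite !big_geq// geq_min.
rewrite big_nat_recr//=; have [nN|Nn] := ltnP n.+1 N; last first.
  move: IH; rewrite !(minn_idPr _)//; last exact: leqW.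
  by move=> /(ler_wnDr (wN _ Nn)).
move: IH; rewrite !(minn_idPl _)// ?(ltnW nN)// => IH.
by rewrite [leRHS]big_nat_recr//= lerD// ler_norm.
Qed.

(** Toeplitz's lemma: [k n -> 0] kills every initial segment of the sum, and in the rest [c] is
    small against weights of bounded total mass. *)
Lemma toeplitz_null (k w c : nat -> R) (C : R) :
  (forall n, 0 <= k n) -> k n @[n --> \oo] --> 0 ->
  (forall j, (1 <= j)%N -> 0 <= w j) ->
  (\forall n \near \oo, k n * \sum_(1 <= j < n) w j <= C) ->
  c n @[n --> \oo] --> 0 ->
  k n * (\sum_(1 <= j < n) w j * c j) @[n --> \oo] --> 0.
Proof.
move=> k0 kcvg w0 kw ccvg; apply/cvgr0Pnorm_le => e e0.
pose C' := `|C| + 1; have C'0 : 0 < C' by rewrite ltr_wpDl.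
pose h := e / (2 * C'); have h0 : 0 < h by rewrite divr_gt0// mulr_gt0.
have /cvgr0Pnorm_le/(_ _ h0)[N _ cN] := ccvg.
have [K KP] : exists K : R,
    forall n, \sum_(1 <= j < n) (`|w j * c j| - h * w j) <= K.
  apply: (@sum_nat_ub _ N.+1) => j Nj; have w0j : 0 <= w j by rewrite w0 ?(leq_trans _ Nj).
  rewrite subr_le0 normrM (ger0_norm w0j) mulrC ler_wpM2r//.
  by apply: cN => /=; exact: ltnW.
pose K' := `|K| + 1; have K'0 : 0 < K' by rewrite ltr_wpDl.
have e'0 : 0 < e / (2 * K') by rewrite divr_gt0// mulr_gt0.
have /cvgr0Pnorm_le/(_ _ e'0) kN := kcvg.
near=> n.
have kC : k n * (\sum_(1 <= j < n) w j) <= C by near: n.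
have : k n <= e / (2 * K') by rewrite -[leLHS]ger0_norm//; near: n.
rewrite ler_pdivlMr ?mulr_gt0// => kK.
rewrite normrM (ger0_norm (k0 n)).
have := KP n; rewrite sumrB -mulr_sumr => S1.
have S2 := ler_norm_sum (index_iota 1 n) (fun j => w j * c j) xpredT.
have : k n * `|\sum_(1 <= j < n) w j * c j| <=
    k n * (K' + h * \sum_(1 <= j < n) w j).
  apply: ler_wpM2l => //; apply: (le_trans S2).
  by rewrite -lerBlDr; apply: (le_trans S1); rewrite /K' (le_trans (ler_norm _))// lerDl.
move=> /le_trans; apply.
have : h * (k n * \sum_(1 <= j < n) w j) <= h * C'.
  rewrite ler_pM2l//; apply: (le_trans kC).
  by rewrite /C' (le_trans (ler_norm _))// lerDl.
have -> : h * C' = e / 2 by rewrite /h; field; rewrite gt_eqF.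
rewrite mulrDr mulrCA; lra.
Unshelve. all: by end_near. Qed.

(** Toeplitz's lemma with the increments of [W] as weights and [x j / (W j.+1 - W j) - l] as null
    sequence. The weights add up to [W n - W 1], and the contribution of [W 1] vanishes in the
    limit. *)
Lemma stolz_cesaro x W (l : R) : (forall j, 0 <= W j) ->
  (forall j, (1 <= j)%N -> W j < W j.+1) -> W n @[n --> \oo] --> +oo ->
  x n / (W n.+1 - W n) @[n --> \oo] --> l ->
  (\sum_(1 <= j < n) x j) / W n @[n --> \oo] --> l.
Proof.
move=> W0 Wlt Wy xl.
pose w j := W j.+1 - W j; pose c j := x j / w j - l.
have sw n : (1 <= n)%N -> \sum_(1 <= j < n) w j = W n - W 1%N.
  by move=> n1; rewrite telescope_sumr.
have Vy : (W n)^-1 @[n --> \oo] --> 0.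
  by apply/gtr0_cvgV0 => //; near=> n; near: n; move/cvgryPgt : Wy; apply.
have w0 j : (1 <= j)%N -> 0 <= w j by move=> j1; rewrite subr_ge0 ltW ?Wlt.
have c0 : c n @[n --> \oo] --> 0.
  by rewrite -(subrr l); apply: cvgB => //; exact: cvg_cst.
have V0 n : 0 <= (W n)^-1 by rewrite invr_ge0.
have kw : \forall n \near \oo, (W n)^-1 * \sum_(1 <= j < n) w j <= 1.
  near=> n; have Wn : 0 < W n by near: n; move/cvgryPgt : Wy; apply.
  rewrite sw; last by near: n; exact: nbhs_infty_ge.
  by rewrite mulrC ler_pdivrMr// mul1r gerBl.
have T := toeplitz_null V0 Vy w0 kw c0.
have T2 : (W n)^-1 * (\sum_(1 <= j < n) w j * c j) + l * (1 - W 1%N * (W n)^-1)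
    @[n --> \oo] --> 0 + l * (1 - W 1%N * 0).
  apply: cvgD; first exact: T.
  apply: cvgM; first exact: cvg_cst.
  apply: cvgB; first exact: cvg_cst.
  by apply: cvgM; first exact: cvg_cst.
move: T2; rewrite mulr0 subr0 mulr1 add0r; apply: cvg_trans.
apply: near_eq_cvg; near=> n.
have n1 : (1 <= n)%N by near: n; exact: nbhs_infty_ge.
have Wn : 0 < W n by near: n; move/cvgryPgt : Wy; apply.
have -> : \sum_(1 <= j < n) w j * c j = \sum_(1 <= j < n) x j - l * (W n - W 1%N).
  rewrite -sw// mulr_sumr -sumrB; apply: eq_big_nat => j /andP[j1 _].
  by rewrite /c; field; rewrite gt_eqF// subr_gt0 Wlt.
by field; rewrite gt_eqF.
Unshelve. all: by end_near. Qed.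

(** Provides the limit required by [stolz_cesaro] when [W] is a power or the logarithm: up to a
    factor, [W n.+1 - W n] is then [f 1 - f (1 - 1/(n+1))]. *)
Lemma cvg_difference_quotient_inv (f : R -> R) (l : R) :
  is_derive (1 : R) (1 : R) f l -> l != 0 ->
  n.+1%:R^-1 / (f 1 - f (1 - n.+1%:R^-1)) @[n --> \oo] --> l^-1.
Proof.
move=> df l0.
pose h n : R := - n.+1%:R^-1.
have h0 : h n @[n --> \oo] --> 0.
  by rewrite -oppr0; apply: cvgN; exact: cvg_harmonic.
have hd : h n @[n --> \oo] --> (0 : R)^'.
  move=> A [e /= e0 eA]; suff : \forall n \near \oo, A (h n) by [].
  near=> n; apply: eA => /=.
    by rewrite sub0r normrN; near: n; move/cvgr0Pnorm_lt : h0; apply.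
  by rewrite /h oppr_eq0 invr_eq0 pnatr_eq0.
have [/cvg_ex[m fm] fl] := df.
have ml : m = l by rewrite -fl; apply/esym/cvg_lim.
have := cvg_comp _ _ hd fm; rewrite ml => /(cvgV l0).
apply: cvg_trans; apply: near_eq_cvg; near=> n.
change (((h n)^-1 * (f (h n * 1 + 1) - f 1))^-1 = n.+1%:R^-1 / (f 1 - f (1 - n.+1%:R^-1))).
by rewrite mulr1 /h [1 - _]addrC invfM invrK -[f 1 - _]opprB invrN mulrN mulNr.
Unshelve. all: by end_near. Qed.

Lemma powR_natS_pred s n : n%:R `^ s = n.+1%:R `^ s * (1 - n.+1%:R^-1) `^ s :> R.
Proof.
rewrite -powRM//; last by rewrite subr_ge0 invf_le1 ?ler1n.
congr (_ `^ _); rewrite mulrBr mulr1 divff ?pnatr_eq0//.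
by rewrite -natr1 addrK.
Qed.

Lemma cvg_powR_pinfty s : 0 < s -> (n%:R `^ s : R) @[n --> \oo] --> +oo.
Proof.
move=> s0; apply/cvgryPge => A; near=> n.
have : (`|A| + 1) `^ s^-1 <= n%:R by near: n; exact: nbhs_infty_ger.
move=> /(ge0_ler_powR (ltW s0)); rewrite !nnegrE powR_ge0 ler0n => /(_ isT isT).
rewrite -powRrM mulVf ?gt_eqF// powRr1 ?addr_ge0//.
by apply: le_trans; rewrite (le_trans (ler_norm _))// lerDl.
Unshelve. all: by end_near. Qed.

Lemma sum_powR_cvg s : 0 < s ->
  (\sum_(1 <= j < n) j.+1%:R `^ (s - 1)) / n%:R `^ s @[n --> \oo] --> (s^-1 : R).
Proof.
move=> s0; apply: stolz_cesaro.
- by move=> j; exact: powR_ge0.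
- by move=> j j1; rewrite gt0_ltr_powR// ?nnegrE// ltr_nat.
- exact: cvg_powR_pinfty.
have d1 := @is_derive1_powR _ s 1 ltr01.
rewrite powR1 mulr1 in d1.
have := cvg_difference_quotient_inv d1 (lt0r_neq0 s0).
apply: cvg_trans; apply: near_eq_cvg; near=> n.
rewrite (powR_natS_pred s n) powR1 -[X in _ = _ / (X - _)]mulr1 -mulrBr.
rewrite powRB; last by rewrite pnatr_eq0 implybT.
rewrite powRr1//; field; rewrite ?mulf_neq0 ?pnatr_eq0//.
have /gt_eqF -> : 0 < n.+1%:R `^ s :> R by rewrite powR_gt0 ?ltr0n.
rewrite nat1r pnatr_eq0 andbT/=.
have : (1 - n.+1%:R^-1) `^ s < 1 :> R.
  have y0 : 0 <= 1 - n.+1%:R^-1 :> R by rewrite subr_ge0 invf_le1 ?ler1n.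
  have := @gt0_ltr_powR _ s s0 (1 - n.+1%:R^-1) 1.
  by rewrite powR1 !nnegrE y0 => -> //; rewrite gtrBl invr_gt0.
by rewrite subr_eq0 eq_sym => /lt_eqF ->.
Unshelve. all: by end_near. Qed.

Lemma cvg_ln_pinfty : (ln n%:R : R) @[n --> \oo] --> +oo.
Proof.
apply/cvgryPge => A; near=> n.
have : expR A <= n%:R by near: n; exact: nbhs_infty_ger.
by move=> An; rewrite -(expRK A) ler_ln// posrE ?expR_gt0// (lt_le_trans _ An)// expR_gt0.
Unshelve. all: by end_near. Qed.

Lemma sum_harmonic_cvg :
  (\sum_(1 <= j < n) j.+1%:R^-1) / ln n%:R @[n --> \oo] --> (1 : R).
Proof.
apply: stolz_cesaro.
(* At index 0 the default value [ln 0 = 0] is used. *)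
- by case=> [|j]; [rewrite ln0|rewrite ln_ge0// ler1n].
- by move=> j j1; rewrite ltr_ln ?posrE ?ltr0n// ltr_nat.
- exact: cvg_ln_pinfty.
have d1 := @is_derive1_ln R 1 ltr01.
rewrite invr1 in d1.
have := cvg_difference_quotient_inv d1 (oner_neq0 _); rewrite invr1.
apply: cvg_trans; apply: near_eq_cvg; near=> n.
rewrite ln1 sub0r.
have n0 : (0 < n)%N by near: n; exact: nbhs_infty_gt.
have -> : 1 - n.+1%:R^-1 = n%:R / n.+1%:R :> R.
  by rewrite -[n.+1]addn1 natrD; field; rewrite natr1 pnatr_eq0.
by rewrite ln_div ?posrE ?ltr0n// opprB.
Unshelve. all: by end_near. Qed.

Lemma ln_le_sub1 (y : R) : 0 < y -> ln y <= y - 1.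
Proof.
move=> y0; rewrite -ler_expR lnK ?posrE//.
by apply: le_trans (expR_ge1Dx _); rewrite addrC subrK.
Qed.

Lemma powR_ge_tangent (y b : R) : 0 < y -> b <= 0 -> 1 + b * (y - 1) <= y `^ b.
Proof.
move=> y0 b0; rewrite /powR gt_eqF//; apply: le_trans (expR_ge1Dx _).
by rewrite lerD2l ler_wnM2l// ln_le_sub1.
Qed.

(** Weighted arithmetic-geometric inequality: with [t] the mean of [y] and 1 for the weights [b] and
    [1 - b], average [ln z <= z - 1] over [z = y / t] and [z = 1 / t]; the right-hand sides
    cancel. *)
Lemma powR_le_tangent (y b : R) : 0 < y -> 0 <= b <= 1 -> y `^ b <= 1 + b * (y - 1).
Proof.
move=> y0 /andP[b0 b1]; set t := 1 + _.
have t0 : 0 < t by rewrite /t; nra.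
rewrite /powR gt_eqF// -[leRHS]lnK ?posrE// ler_expR.
have h1 := ln_le_sub1 (divr_gt0 y0 t0).
have it0 : 0 < t^-1 by rewrite invr_gt0.
have h2 := ln_le_sub1 it0.
rewrite ln_div ?posrE// in h1; rewrite lnV ?posrE// in h2.
have : b * (ln y - ln t) + (1 - b) * - ln t <= b * (y / t - 1) + (1 - b) * (t^-1 - 1).
  by apply: lerD; apply: ler_wpM2l => //; rewrite subr_ge0.
have -> : b * (y / t - 1) + (1 - b) * (t^-1 - 1) = 0.
  by rewrite /t; field; rewrite gt_eqF.
lra.
Qed.

(** Discrete integral comparison: by the tangent inequality at [1 - 1/(j+1)], each term is at most
    [(j^(-e) - (j+1)^(-e)) / e], and these telescope. *)
Lemma sum_powR_tail (e : R) m n : 0 < e -> (1 <= m)%N ->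
  \sum_(m <= j < n) j.+1%:R `^ (- 1 - e) <= m%:R `^ (- e) / e.
Proof.
move=> e0 m1; have [mn|nm] := leqP m n; last first.
  by rewrite big_geq ?(ltnW nm)// divr_ge0 ?powR_ge0 ?ltW.
apply: (@le_trans _ _ ((m%:R `^ (- e) - n%:R `^ (- e)) / e)); last first.
  by rewrite ler_wpM2r ?invr_ge0 ?(ltW e0)// gerBl powR_ge0.
have /= tel := telescope_sumr (fun j => j%:R `^ (- e) : R) mn.
rewrite -[m%:R `^ _ - _]opprB -tel -sumrN mulr_suml.
apply: ler_sum_nat => j /andP[mj _].
have j0 : (0 < j)%N by exact: leq_trans mj.
rewrite opprB ler_pdivlMr// (powR_natS_pred (- e) j).
have y0 : 0 < 1 - j.+1%:R^-1 :> R by rewrite subr_gt0 invf_lt1 ?ltr1n.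
have := @powR_ge_tangent (1 - j.+1%:R^-1) (- e) y0; rewrite oppr_le0 (ltW e0).
move=> /(_ isT); have -> : 1 - j.+1%:R^-1 - 1 = - j.+1%:R^-1 :> R by ring.
rewrite mulrNN => H.
have -> : - 1 - e = - e - 1 by ring.
rewrite powRB; last by rewrite pnatr_eq0 implybT.
rewrite powRr1// -[X in _ <= _ - X]mulr1 -mulrBr -mulrA.
by rewrite ler_wpM2l ?powR_ge0// mulrC lerBrDl.
Qed.

(** * The weights [n^(-a)] *)

Section Weights.
Variable a : R.
Hypothesis a1 : -1 <= a <= 1.
Definition weight (n : nat) : R := n%:R `^ (- a).
Local Notation u := weight.

Lemma weight_ge0 n : 0 <= u n. Proof. exact: powR_ge0. Qed.

Lemma weightS j : (1 <= j)%N -> u j.+1 = u j * (1 + j%:R^-1) `^ (- a).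
Proof.
move=> j1; rewrite /weight -powRM// ?addr_ge0 ?invr_ge0//; congr (_ `^ _).
by rewrite mulrDr mulr1 divff ?natr1// pnatr_eq0 -lt0n.
Qed.

Lemma weight_le_double j : (1 <= j)%N -> u j <= 2 * u j.+1.
Proof.
move=> j1; have [_ ha] := andP a1; rewrite weightS// mulrCA ler_peMr ?weight_ge0//.
have h1 : 1 <= 1 + j%:R^-1 :> R by rewrite lerDl invr_ge0.
have h2 : j%:R^-1 <= 1 :> R by rewrite invf_le1 ?ler1n ?ltr0n.
have : (1 + j%:R^-1) `^ (-1) <= (1 + j%:R^-1) `^ (- a) :> R.
  by rewrite ler_powR// lerN2.
rewrite powR_inv1 ?(le_trans _ h1)// => H.
have : 2^-1 <= (1 + j%:R^-1)^-1 :> R.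
  by rewrite lef_pV2 ?posrE// ?(lt_le_trans _ h1)//; lra.
lra.
Qed.

(** With [h = 1/j], the first-order terms of [(1 + h)^(-a) * (1 + a h)] cancel. Tangent inequalities
    from both sides replace a Taylor expansion; they need an exponent in [0, 1], hence the case
    distinction on the sign of [a]. *)
Lemma weight_drift j : (1 <= j)%N ->
  `|u j.+1 * (1 + a / j%:R) - u j| <= u j * (j%:R^-1) ^+ 2.
Proof.
move=> j1; rewrite weightS//; set h : R := j%:R^-1.
have h0 : 0 < h by rewrite invr_gt0 ltr0n.
have h1 : h <= 1 by rewrite invf_le1 ?ler1n ?ltr0n.
have -> : u j * (1 + h) `^ (- a) * (1 + a * h) - u j =
  u j * ((1 + h) `^ (- a) * (1 + a * h) - 1) by ring.
rewrite normrM (ger0_norm (weight_ge0 _)) ler_wpM2l ?weight_ge0//.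
have P_le b : 0 <= b <= 1 -> (1 + h) `^ b <= 1 + b * h.
  by move=> b1; have := @powR_le_tangent (1 + h) b _ b1; rewrite [1 + h]addrC addrK; apply; lra.
(* The tangent inequality at [1 / (1 + h)], cleared of its denominator. *)
have V_le b : 0 <= b <= 1 -> (1 + h) `^ (- b) * (1 + h) <= 1 + h - b * h.
  move=> b1; have := @powR_le_tangent (1 + h)^-1 b _ b1.
  rewrite -[X in X `^ b]powR_inv1 -?powRrM ?mulN1r; last lra.
  have -> : 1 + b * ((1 + h)^-1 - 1) = (1 + h - b * h) / (1 + h).
    by field; rewrite gt_eqF//; lra.
  by rewrite ler_pdivlMr; [apply; rewrite invr_gt0; lra|lra].
have PV b : (1 + h) `^ b * (1 + h) `^ (- b) = 1.
  by rewrite powRN divff// gt_eqF// powR_gt0//; lra.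
have [am1 ap1] := andP a1; have [ap|an] := leP 0 a.
  have a01 : 0 <= a <= 1 by rewrite ap.
  have := P_le _ a01; have := V_le _ a01; have := PV a.
  have : 0 < (1 + h) `^ a by rewrite powR_gt0//; lra.
  have : 0 < (1 + h) `^ (- a) by rewrite powR_gt0//; lra.
  move: ((1 + h) `^ a) ((1 + h) `^ (- a)) => P V V0 P0 PV1 VL PL.
  have VPL : V * P <= V * (1 + a * h) by rewrite ler_wpM2l// ltW.
  rewrite ger0_norm; last by lra.
  have : V * (1 + h) * (1 + a * h) <= (1 + h - a * h) * (1 + a * h).
    by rewrite ler_wpM2r//; nra.
  nra.
have a01 : 0 <= - a <= 1 by apply/andP; split; lra.
have := P_le _ a01; have := V_le _ a01; have := PV (- a); rewrite opprK.
have : 0 < (1 + h) `^ a by rewrite powR_gt0//; lra.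
have : 0 < (1 + h) `^ (- a) by rewrite powR_gt0//; lra.
move: ((1 + h) `^ (- a)) ((1 + h) `^ a) => P V P0 V0 PV1 VL PL.
rewrite ler_norml; apply/andP; split.
  have : h * P <= h * (1 - a * h) by rewrite ler_wpM2l ?(ltW h0)// -mulNr.
  nra.
have : (1 + a * h) * P <= (1 + a * h) * (1 - a * h).
  by rewrite ler_wpM2l -?mulNr//; have := ler_wpM2r (ltW h0) am1; lra.
nra.
Qed.

End Weights.

(** Meant for [y n = E S_n^2]. Dividing the recursion by [n + 1] turns it into an additive one for
    [y n / n], so [y n / n^2] is bounded by a null term plus a Cesaro mean of [|c j| / j]. *)
Lemma sqr_growth_cvg0 (y c : nat -> R) : (forall n, 0 <= y n) ->
  (forall n, (1 <= n)%N -> y n.+1 <= (1 + n%:R^-1) * y n + c n) ->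
  c n / n%:R @[n --> \oo] --> 0 ->
  y n / n%:R ^+ 2 @[n --> \oo] --> 0.
Proof.
move=> y0 yS c0.
have yn n : y n.+1 / n.+1%:R <= y 1%N + \sum_(1 <= j < n.+1) 1 * `|c j / j%:R|.
  elim: n => [|n IH]; first by rewrite divr1 big_geq ?addr0.
  rewrite big_nat_recr//= addrA mul1r; apply: le_trans (lerD IH (lexx _)).
  rewrite ler_pdivrMr ?ltr0n//; apply: (le_trans (yS _ _)) => //.
  rewrite [leRHS]mulrDl; apply: lerD.
    rewrite le_eqVlt; apply/orP; left; apply/eqP.
    by rewrite -[n.+2%:R]natr1; field; rewrite nat1r pnatr_eq0.
  apply: (le_trans (ler_norm _)).
  rewrite normrM normfV (ger0_norm (ler0n _ n.+1)) -mulrA ler_peMr//.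
  by rewrite mulrC ler_pdivlMr ?ltr0n// mul1r ler_nat.
have Vn : n%:R^-1 @[n --> \oo] --> (0 : R).
  apply/gtr0_cvgV0; last exact: cvgr_idn.
  by near=> n; rewrite ltr0n; near: n; exact: nbhs_infty_gt.
have T : n%:R^-1 * (\sum_(1 <= j < n) 1 * `|c j / j%:R|) @[n --> \oo] --> 0.
  apply: (@toeplitz_null (fun n => n%:R^-1) (fun=> 1) (fun j => `|c j / j%:R|) 1) => //.
    near=> n; rewrite sumr_const_nat.
    have n0 : (0 < n)%N by near: n; exact: nbhs_infty_gt.
    by rewrite mulrC ler_pdivrMr ?ltr0n// mul1r ler_nat leq_subr.
  by rewrite -(normr0 R); apply: cvg_norm.
have T2 : y 1%N * n%:R^-1 + n%:R^-1 * (\sum_(1 <= j < n) 1 * `|c j / j%:R|)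
    @[n --> \oo] --> 0.
  rewrite -[X in _ --> X]addr0; apply: cvgD => //.
  rewrite -[X in _ --> X](mulr0 (y 1%N)); apply: cvgM => //; exact: cvg_cst.
apply: (squeeze_cvgr _ (cvg_cst 0) T2).
near=> n; apply/andP; split; first by rewrite divr_ge0 ?sqr_ge0.
have n0 : (0 < n)%N by near: n; exact: nbhs_infty_gt.
rewrite -(prednK n0) expr2 invfM mulrA.
have := yn n.-1; move/(ler_wpM2r (_ : 0 <= n.-1.+1%:R^-1)) => /(_ _) H.
by rewrite [y 1%N * _]mulrC -mulrDr mulrC [leRHS]mulrC mulrC H.
Unshelve. all: by end_near. Qed.

End Sums.

(** * Expectations and functions of finitely many values *)

Section Expectation.
Context d (T : measurableType d) (R : realType) (P : probability T R).
Implicit Types (f g : T -> R) (A B : set T).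

Definition bounded_rv f :=
  measurable_fun setT f /\ exists C, forall w, `|f w| <= C.

Definition Ex f : R := (\int[P]_w f w)%R.

Lemma bounded_rv_integrable f : bounded_rv f -> P.-integrable setT (EFin \o f).
Proof.
move=> [mf [C fC]]; apply: measurable_bounded_integrable => //.
  by rewrite (le_lt_trans (probability_le1 _ _)) ?ltry.
exists C; split; first exact: num_real.
by move=> x Cx w _ /=; apply: (le_trans (fC w)); exact: ltW.
Qed.

Lemma bounded_rv_cst (c : R) : bounded_rv (fun=> c).
Proof. by split; [exact: measurable_cst|exists `|c|]. Qed.

Lemma bounded_rvD f g : bounded_rv f -> bounded_rv g ->
  bounded_rv (fun w => f w + g w).
Proof.
move=> [mf [C fC]] [mg [K gK]]; split; first exact: measurable_funD.
by exists (C + K) => w; apply: (le_trans (ler_normD _ _)); exact: lerD.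
Qed.

Lemma bounded_rvM f g : bounded_rv f -> bounded_rv g ->
  bounded_rv (fun w => f w * g w).
Proof.
move=> [mf [C fC]] [mg [K gK]]; split; first exact: measurable_funM.
by exists (C * K) => w; rewrite normrM; exact: ler_pM.
Qed.

Lemma bounded_rvB f g : bounded_rv f -> bounded_rv g ->
  bounded_rv (fun w => f w - g w).
Proof.
move=> [mf [C fC]] [mg [K gK]]; split; first exact: measurable_funB.
by exists (C + K) => w; apply: (le_trans (ler_normB _ _)); exact: lerD.
Qed.

Lemma bounded_rv_sum (I : Type) (s : seq I) (F : I -> T -> R) :
  (forall i, bounded_rv (F i)) -> bounded_rv (fun w => \sum_(i <- s) F i w).
Proof.
move=> bF; elim: s => [|i s IH].
  by under eq_fun do rewrite big_nil; exact: bounded_rv_cst.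
by under eq_fun do rewrite big_cons; exact: bounded_rvD.
Qed.

Lemma bounded_rv_indic A : measurable A -> bounded_rv (\1_A).
Proof.
move=> mA; split; first exact: measurable_indic.
by exists 1 => w; rewrite indicE normr_nat lern1 leq_b1.
Qed.

Lemma ExD f g : bounded_rv f -> bounded_rv g ->
  Ex (fun w => f w + g w) = Ex f + Ex g.
Proof. by move=> bf bg; apply: RintegralD => //; exact: bounded_rv_integrable. Qed.

Lemma ExB f g : bounded_rv f -> bounded_rv g ->
  Ex (fun w => f w - g w) = Ex f - Ex g.
Proof. by move=> bf bg; apply: RintegralB => //; exact: bounded_rv_integrable. Qed.

Lemma ExZ (c : R) f : bounded_rv f -> Ex (fun w => c * f w) = c * Ex f.
Proof. by move=> bf; apply: RintegralZl => //; exact: bounded_rv_integrable. Qed.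

Lemma Ex_cst (c : R) : Ex (fun=> c) = c.
Proof.
rewrite /Ex Rintegral_cst// (_ : fine _ = 1) ?mulr1//.
by rewrite -[RHS]/(fine 1%E); congr fine; exact: probability_setT.
Qed.

Lemma Ex_le f g : bounded_rv f -> bounded_rv g -> (forall w, f w <= g w) ->
  Ex f <= Ex g.
Proof.
by move=> bf bg fg; apply: le_Rintegral => //; exact: bounded_rv_integrable.
Qed.

Lemma Ex_ge0 f : (forall w, 0 <= f w) -> 0 <= Ex f.
Proof. by move=> f0; exact: Rintegral_ge0. Qed.

Lemma Ex_norm_le f : bounded_rv f -> `|Ex f| <= Ex (fun w => `|f w|).
Proof. by move=> bf; apply: le_normr_Rintegral => //; exact: bounded_rv_integrable. Qed.

Lemma Ex_sum (I : Type) (s : seq I) (F : I -> T -> R) :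
  (forall i, bounded_rv (F i)) ->
  Ex (fun w => \sum_(i <- s) F i w) = \sum_(i <- s) Ex (F i).
Proof.
move=> bF; elim: s => [|i s IH].
  by under eq_fun do rewrite big_nil; rewrite Ex_cst big_nil.
under eq_fun do rewrite big_cons.
by rewrite ExD ?IH ?big_cons//; exact: bounded_rv_sum.
Qed.

Lemma Ex_indic A : measurable A -> Ex \1_A = fine (P A).
Proof.
by move=> mA; rewrite /Ex /Rintegral integral_indic// setIT.
Qed.

End Expectation.

(** * Maps with finitely many values in place of sigma-algebras *)

Section FiniteCode.
Context d (T : measurableType d) (R : realType) (P : probability T R).

(* A map with finitely many values, each taken on an event: it generates a
   finite sub-sigma-algebra of events. *)
Definition fin_code (C : choiceType) (c : T -> C) :=
  finite_set (range c) /\ forall x, measurable (c @^-1` [set x]).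

(** Measurability with respect to the sigma-algebra of [c], in a form that asks for no structure on
    the codomain. *)
Definition adapted (C : choiceType) (c : T -> C) (A : Type) (f : T -> A) :=
  forall w w', c w = c w' -> f w = f w'.

Lemma fin_code_measurable (C : choiceType) (c : T -> C) (V : set C) :
  fin_code c -> measurable (c @^-1` V).
Proof.
move=> [fc mc]; rewrite (_ : _ @^-1` _ = \bigcup_(x in V `&` range c) c @^-1` [set x]).
  apply: fin_bigcup_measurable => //.
  exact: sub_finite_set fc.
apply/seteqP; split=> [w Vw|w [x [Vx _] /= ->]]//.
by exists (c w).
Qed.

Lemma fin_code_comp (C C' : choiceType) (c : T -> C) (h : C -> C') :
  fin_code c -> fin_code (h \o c).
Proof.
move=> fc; split; last by move=> x; exact: (fin_code_measurable (h @^-1` [set x])).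
by case: fc => fc _; have := finite_image h fc; rewrite image_comp.
Qed.

Lemma fin_code_pair (C C' : choiceType) (c : T -> C) (c' : T -> C') :
  fin_code c -> fin_code c' -> fin_code (fun w => (c w, c' w)).
Proof.
move=> [fc mc] [fc' mc']; split.
  apply: sub_finite_set (finite_setX fc fc') => _ [w _ <-].
  by split; exists w.
move=> [x x']; rewrite (_ : _ @^-1` _ = c @^-1` [set x] `&` c' @^-1` [set x']).
  exact: measurableI.
by apply/seteqP; split=> w /=; [case=> -> ->|case=> -> ->].
Qed.

Lemma fin_code_seq (C : choiceType) (c : nat -> T -> C) (l : seq nat) :
  (forall k, k \in l -> fin_code (c k)) -> fin_code (fun w => [seq c k w | k <- l]).
Proof.
elim: l => [_|k l IH fc].
  split; first by apply: sub_finite_set (finite_set1 [::]) => _ [w _ <-].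
  move=> x; have [->|x0] := pselect (x = [::]).
    by rewrite (_ : _ @^-1` _ = setT)//; apply/seteqP; split.
  rewrite (_ : _ @^-1` _ = set0)//; apply/seteqP; split => // w /= e.
  by apply: x0; rewrite -e.
apply: (@fin_code_comp _ _ (fun w => (c k w, [seq c j w | j <- l]))
  (fun xs => xs.1 :: xs.2)).
apply: fin_code_pair; first by apply: fc; rewrite mem_head.
by apply: IH => j jl; apply: fc; rewrite inE jl orbT.
Qed.

Lemma fin_code_bool (b : T -> bool) : measurable [set w | b w] -> fin_code b.
Proof.
move=> mb; split; first exact: finite_finset.
case; first by rewrite (_ : _ @^-1` _ = [set w | b w]).
rewrite (_ : _ @^-1` _ = ~` [set w | b w]); first exact: measurableC.
by apply/seteqP; split=> w /=; case: (b w).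
Qed.

(* On the finitely many values of a code, an adapted function is a linear
   combination of indicators. *)
Lemma adapted_decomposition (C : choiceType) (c : T -> C) (f : T -> R) :
  fin_code c -> adapted c f ->
  exists s : seq T, forall w, f w = \sum_(t <- s) f t * \1_(c @^-1` [set c t]) w.
Proof.
move=> [fc mc] af.
pose L := fset_set (range c).
have [[t0 _]|noT] := pselect (exists t0 : T, True); last first.
  by exists [::] => w; case: noT; exists w.
have [g gP] : exists g : C -> T, forall x, range c x -> c (g x) = x.
  exists (fun x => if pselect (range c x) is left h then sval (cid2 h) else t0).
  by move=> x rx; case: pselect => // h; case: cid2.
exists [seq g x | x <- L] => w; rewrite big_map.
have wL : c w \in (L : seq C) by rewrite in_fset_set// inE; exists w.
rewrite (bigD1_seq (c w))//= big_seq_cond big1 => [|x /andP[xL xw]].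
  have cg : c (g (c w)) = c w by apply: gP; exists w.
  by rewrite addr0 (af _ _ cg) indicE mem_set ?mulr1//= cg.
rewrite indicE memNset ?mulr0//=.
rewrite in_fset_set// inE in xL; rewrite gP// => cwx.
by move: xw; rewrite cwx eqxx.
Qed.

Lemma adapted_bounded_rv (C : choiceType) (c : T -> C) (f : T -> R) :
  fin_code c -> adapted c f -> bounded_rv f.
Proof.
move=> fc af; have [s sf] := adapted_decomposition fc af.
rewrite (_ : f = fun w => \sum_(t <- s) f t * \1_(c @^-1` [set c t]) w).
  apply: bounded_rv_sum => t; apply: bounded_rvM; first exact: bounded_rv_cst.
  by apply: bounded_rv_indic; case: fc.
by apply/funext => w; rewrite -sf.
Qed.

(** By linearity, independence of [B] from the atoms of the code is enough. *)
Lemma Ex_adapted_indep (C : choiceType) (c : T -> C) (f : T -> R) (B : set T) :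
  fin_code c -> adapted c f -> measurable B ->
  (forall x, P (c @^-1` [set x] `&` B) = (P (c @^-1` [set x]) * P B)%E) ->
  Ex P (fun w => f w * \1_B w) = Ex P f * fine (P B).
Proof.
move=> fc af mB cB; have [s sf] := adapted_decomposition fc af.
have mc t : measurable (c @^-1` [set c t]) by case: fc.
rewrite (_ : (fun w => f w * \1_B w) =
    fun w => \sum_(t <- s) f t * \1_(c @^-1` [set c t] `&` B) w); last first.
  apply/funext => w; rewrite {1}sf mulr_suml; apply: eq_bigr => t _.
  by rewrite indicI mulrA.
rewrite [in RHS](_ : f = fun w => \sum_(t <- s) f t * \1_(c @^-1` [set c t]) w); last first.
  by apply/funext => w; rewrite -sf.
rewrite !Ex_sum; last 2 first.
- move=> t; apply: bounded_rvM; first exact: bounded_rv_cst.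
  exact: bounded_rv_indic.
- move=> t; apply: bounded_rvM; first exact: bounded_rv_cst.
  by apply: bounded_rv_indic; exact: measurableI.
rewrite mulr_suml; apply: eq_bigr => t _.
rewrite !ExZ; [|exact: bounded_rv_indic|by apply: bounded_rv_indic; exact: measurableI].
rewrite !Ex_indic//; last exact: measurableI.
by rewrite cB fineM ?fin_num_measure// mulrA.
Qed.

End FiniteCode.

(** * Separating one variable from those before it *)

Section Independence.
Context d (T : measurableType d) (R : realType) (P : probability T R).

Lemma g_sigma_algebra_setT (S : Type) (G : set (set S)) : <<s G >> setT.
Proof.
have [h0 hD _] := smallest_sigma_algebra (@setT S) G.
by have := hD _ h0; rewrite setD0.
Qed.

Lemma g_sigma_algebra_setI (S : Type) (G : set (set S)) (A B : set S) :
  <<s G >> A -> <<s G >> B -> <<s G >> (A `&` B).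
Proof.
have [h0 hD hU] := smallest_sigma_algebra (@setT S) G.
move=> gA gB; rewrite (_ : A `&` B = setT `\` \bigcup_n bigcup2 (setT `\` A) (setT `\` B) n).
  by apply: (hD); apply: hU => -[|[|n]] /=; [exact: hD|exact: hD|].
by rewrite bigcup2E !setTD setCU !setCK.
Qed.

Lemma sigma_rv_preimage (S : Type) d' (V : measurableType d') (f : S -> V) (B : set V) :
  measurable B -> sigma_rv f (f @^-1` B).
Proof. by move=> mB; exists B => //; rewrite setTI. Qed.

(** The product rule is applied twice: to [J], and to [J] enlarged by [m] with [B] as the event at
    [m]. *)
Lemma mutually_independent_split (A : set nat) (F : nat -> set (set T))
    (J : {fset nat}) (E : nat -> set T) (m : nat) (B : set T) :
  mutually_independent P A F -> (forall i, i \in J -> A i /\ F i (E i)) ->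
  m \notin J -> A m -> F m B ->
  P (\bigcap_(i in [set` J]) E i `&` B) = (P (\bigcap_(i in [set` J]) E i) * P B)%E.
Proof.
move=> ind JE mJ Am FB.
pose E' i := if i == m then B else E i.
have E'm : E' m = B by rewrite /E' eqxx.
have JE' i : i \in J -> E' i = E i.
  by rewrite /E'; case: eqP => // -> mJ'; rewrite mJ' in mJ.
have := ind (m |` J)%fset E'; rewrite big_fsetU1//= E'm.
rewrite (_ : \bigcap_(i in _) E' i = \bigcap_(i in [set` J]) E i `&` B); last first.
  apply/seteqP; split=> [w h|w [h Bw] i /=].
    split; last by have := h m; rewrite E'm; apply; rewrite /= !inE eqxx.
    by move=> i iJ; rewrite -JE'//; apply: h; rewrite /= !inE [i \in J]iJ orbT.
  rewrite !inE /E'; case: eqP => //= _ iJ; exact: h.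
move=> -> //.
  rewrite ind// muleC; congr (_ * _)%E.
  by apply: eq_big_seq => i iJ; rewrite JE'.
move=> i; rewrite !inE => /predU1P[->|iJ]; first by rewrite E'm.
by rewrite JE'//; exact: JE.
Qed.

(** The innovations start at index 2: the list covers the indices from 2 to [m + 1], and [m + 2] is
    the next one. *)
Lemma indep_seq_split d' (V : measurableType d') (Z : nat -> T -> V)
    (C : choiceType) (h : V -> C) (m : nat) (v : seq C) (B : set T) :
  (forall x, measurable (h @^-1` [set x])) ->
  mutually_independent P [set n | (2 <= n)%N] (fun n => sigma_rv (Z n)) ->
  sigma_rv (Z m.+2) B ->
  P ([set w | [seq h (Z k w) | k <- iota 2 m] = v] `&` B) =
  (P [set w | [seq h (Z k w) | k <- iota 2 m] = v] * P B)%E.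
Proof.
move=> mh ind ZB; have [vm|vm] := eqVneq (size v) m; last first.
  rewrite (_ : [set w | _ ] = set0) ?set0I ?measure0 ?mul0e//.
  apply/seteqP; split=> // w /= e.
  by move: vm; rewrite -e size_map size_iota eqxx.
case: v vm => [|x0 v'] vm.
  move: vm => /= <- /=.
  rewrite (_ : [set w | _ ] = setT) ?setTI ?probability_setT ?mul1e//.
  by apply/seteqP; split.
set v := x0 :: v' in vm *.
pose E i := Z i @^-1` (h @^-1` [set nth x0 v (i - 2)]).
pose J := [fset i in iota 2 m]%fset.
rewrite (_ : [set w | _] = \bigcap_(i in [set` J]) E i).
  apply: (mutually_independent_split (m := m.+2) ind) => //.
    move=> i; rewrite inE/= mem_iota => /andP[i2 _]; split => //.
    exact: sigma_rv_preimage.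
  by rewrite inE/= mem_iota !addSn ltnn andbF.
apply/seteqP; split=> [w /= e i /=|w /= Jw].
  rewrite inE/= mem_iota => /andP[i2 im]; rewrite /E/= -e.
  rewrite (nth_map 0%N) ?size_iota; last by rewrite ltn_subLR.
  by rewrite nth_iota ?ltn_subLR// subnKC.
apply: (@eq_from_nth _ x0); rewrite size_map size_iota// => i im.
rewrite (nth_map 0%N) ?size_iota// nth_iota//.
have := Jw (2 + i)%N; rewrite /E/= addKn; apply.
by rewrite inE/= mem_iota leq_addr ltn_add2l.
Qed.

End Independence.

(** * The past of the walk *)

Section History.
Context d (T : measurableType d) (R : realType) (P : probability T R).
Context (p lambda : R) (D : nat -> T -> {fset nat}).
Context (X Y eps : nat -> {RV P >-> R}) (I : nat -> {RV P >-> nat}).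
Hypothesis HX : TMERW P p lambda D X Y eps I.

(** Filling some places with the full set also gives the product rule for fewer families. *)
Lemma tmerw_indep5 (E0 E1 E2 E3 E4 : set T) :
  sigma_rv (X 1%N) E0 -> sigma_fsets [set n | (1 <= n)%N] D E1 ->
  sigma_process [set n | (2 <= n)%N] (fun n => Y n : T -> R) E2 ->
  sigma_process [set n | (2 <= n)%N] (fun n => eps n : T -> R) E3 ->
  sigma_process [set n | (2 <= n)%N] (fun n => I n : T -> nat) E4 ->
  P (E0 `&` (E1 `&` (E2 `&` (E3 `&` E4)))) =
  (P E0 * (P E1 * (P E2 * (P E3 * P E4))))%E.
Proof.
move=> h0 h1 h2 h3 h4; pose E := tnth [tuple E0; E1; E2; E3; E4].
have := tmerw_indep HX (J := [fset i in enum 'I_5]%fset) (E := E).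
have -> : \bigcap_(i in [set` [fset i in enum 'I_5]%fset]) E i =
    E0 `&` (E1 `&` (E2 `&` (E3 `&` E4))).
  apply/seteqP; split=> [w h|w [? [? [? [? ?]]]] i _].
    have {}h i : E i w by apply: h; rewrite /= inE/= mem_enum.
    do ![split]; [exact: (h (@Ordinal 5 0 isT))
      |exact: (h (@Ordinal 5 1 isT))|exact: (h (@Ordinal 5 2 isT))
      |exact: (h (@Ordinal 5 3 isT))|exact: (h (@Ordinal 5 4 isT))].
  by case: i => -[|[|[|[|[|]]]]].
have -> : (\prod_(i <- [fset i in enum 'I_5]%fset) P (E i) =
    \prod_(i < 5) P (E i))%E.
  rewrite -[RHS]big_enum; apply: perm_big; apply: uniq_perm.
  - exact: fset_uniq.
  - exact: enum_uniq.
  - by move=> i; rewrite inE.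
rewrite !big_ord_recl big_ord0 mule1; apply => i _; split => //.
by case: i => -[|[|[|[|[|]]]]].
Qed.

Lemma g_sigma_algebra_seq (S : Type) (C : choiceType) (G : set (set S))
    (f : nat -> S -> C) (l : seq nat) (v : seq C) :
  (forall k x, k \in l -> <<s G >> [set w | f k w = x]) ->
  <<s G >> [set w | [seq f k w | k <- l] = v].
Proof.
elim: l v => [|k l IH] [|x v] fG.
- rewrite (_ : [set w | _] = setT); first exact: g_sigma_algebra_setT.
  by apply/seteqP; split.
- rewrite (_ : [set w | _] = set0); last by apply/seteqP; split.
  by have [] := smallest_sigma_algebra (@setT S) G.
- rewrite (_ : [set w | _] = set0); last by apply/seteqP; split.
  by have [] := smallest_sigma_algebra (@setT S) G.
rewrite (_ : [set w | _] = [set w | f k w = x] `&` [set w | [seq f j w | j <- l] = v]).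
  apply: g_sigma_algebra_setI; first by apply: fG; rewrite mem_head.
  by apply: IH => j y jl; apply: fG; rewrite inE jl orbT.
by apply/seteqP; split=> w /= [-> ->].
Qed.

Lemma sigma_process_seq d' (V : measurableType d') (Z : nat -> T -> V)
    (C : choiceType) (h : V -> C) (m : nat) (v : seq C) :
  (forall x, measurable (h @^-1` [set x])) ->
  sigma_process [set n | (2 <= n)%N] Z [set w | [seq h (Z k w) | k <- iota 2 m] = v].
Proof.
move=> mh; apply: g_sigma_algebra_seq => k x; rewrite mem_iota => /andP[k2 _].
by apply: sub_sigma_algebra; exists k => //; exact: (sigma_rv_preimage _ (mh x)).
Qed.

Lemma sigma_process_rv d' (V : measurableType d') (Z : nat -> T -> V) n (B : set T) :
  (2 <= n)%N -> sigma_rv (Z n) B -> sigma_process [set n | (2 <= n)%N] Z B.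
Proof. by move=> n2 ZB; apply: sub_sigma_algebra; exists n. Qed.

(** The event is a countable intersection of membership events and complements of such events. *)
Lemma sigma_fsets_eq k (A : {fset nat}) : (1 <= k)%N ->
  sigma_fsets [set n | (1 <= n)%N] D [set w | D k w = A].
Proof.
move=> k1; rewrite /sigma_fsets; set G := [set _ | _].
have [h0 hD hU] := smallest_sigma_algebra (@setT T) G.
have GD j : <<s G >> [set w | j \in D k w] by apply: sub_sigma_algebra; exists k, j.
rewrite (_ : [set w | _] = setT `\` \bigcup_j
    (if j \in A then setT `\` [set w | j \in D k w] else [set w | j \in D k w])).
  by apply: (hD); apply: hU => j; case: ifP => _ //; exact: hD.
apply/seteqP; split=> [w /= DA|w [_ /= h]].
  split => // -[j _]; rewrite -DA; case: ifP => jD /=.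
    by move=> [_]; rewrite jD.
  by rewrite jD.
apply/fsetP => j; apply/idP/idP => jD; apply/negP => /negP jN.
  by apply: h; exists j => //; rewrite (negbTE jN).
by apply: h; exists j => //; rewrite jD; split => //; exact/negP.
Qed.

Lemma measurable_eq1 (b : bool) : measurable ((fun x : R => x == 1) @^-1` [set b]).
Proof.
have m1 : measurable [set (1 : R)] by exact: measurable_set1.
case: b.
  rewrite (_ : (fun x : R => x == 1) @^-1` [set true] = [set 1])//.
  by apply/seteqP; split=> x /=; [move/eqP|move=> ->; rewrite eqxx].
rewrite (_ : (fun x : R => x == 1) @^-1` [set false] = ~` [set 1]).
  exact: measurableC.
by apply/seteqP; split=> x /=; [move=> /eqP|move=> /eqP /negbTE].
Qed.

(** The past up to time [n]. It contains [D n], which governs step [n + 1]. Only the tests [Y = 1]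
    and [eps = 1] are recorded, because on a null set these variables may take infinitely many
    values. The lists of length [n.-1] run over the indices from 2 to [n]. *)
Definition history (n : nat) (w : T) :=
  (X 1%N w == 1,
    ([seq D k w | k <- iota 1 n],
      ([seq Y k w == 1 | k <- iota 2 n.-1],
        ([seq eps k w == 1 | k <- iota 2 n.-1], [seq I k w | k <- iota 2 n.-1])))).

(** Two layers of independence: the product rule for the five families, and inside each of the three
    innovation sequences the separation of its last member. *)
Lemma history_indep n x (BY Be BI : set T) :
  sigma_rv (Y n.+2) BY -> sigma_rv (eps n.+2) Be -> sigma_rv (I n.+2) BI ->
  P (history n.+1 @^-1` [set x] `&` (BY `&` (Be `&` BI))) =
  (P (history n.+1 @^-1` [set x]) * (P BY * (P Be * P BI)))%E.
Proof.
move=> hY he hI; case: x => x0 [x1 [x2 [x3 x4]]].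
pose E0 := [set w | (X 1%N w == 1) = x0].
pose E1 := [set w | [seq D k w | k <- iota 1 n.+1] = x1].
pose E2 := [set w | [seq Y k w == 1 | k <- iota 2 n] = x2].
pose E3 := [set w | [seq eps k w == 1 | k <- iota 2 n] = x3].
pose E4 := [set w | [seq I k w | k <- iota 2 n] = x4].
have -> : history n.+1 @^-1` [set (x0, (x1, (x2, (x3, x4))))] =
    E0 `&` (E1 `&` (E2 `&` (E3 `&` E4))).
  apply/seteqP; split=> w; first by case=> *; do !split.
  move=> -[e0 [e1 [e2 [e3 e4]]]].
  exact: (f_equal2 pair e0 (f_equal2 pair e1 (f_equal2 pair e2 (f_equal2 pair e3 e4)))).
have mI (x : nat) : measurable ((fun i : nat => i) @^-1` [set x]) by [].
have s0 : sigma_rv (X 1%N) E0 by exact: (sigma_rv_preimage _ (measurable_eq1 x0)).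
have s1 : sigma_fsets [set n | (1 <= n)%N] D E1.
  by apply: g_sigma_algebra_seq => k y; rewrite mem_iota => /andP[k1 _]; exact: sigma_fsets_eq.
have s2 : sigma_process [set n | (2 <= n)%N] (fun n => Y n : T -> R) E2.
  by apply: (sigma_process_seq (h := fun x : R => x == 1)); exact: measurable_eq1.
have s3 : sigma_process [set n | (2 <= n)%N] (fun n => eps n : T -> R) E3.
  by apply: (sigma_process_seq (h := fun x : R => x == 1)); exact: measurable_eq1.
have s4 : sigma_process [set n | (2 <= n)%N] (fun n => I n : T -> nat) E4.
  by apply: (sigma_process_seq (h := fun x : nat => x)); exact: mI.
rewrite [X in P X = _](_ : _ = E0 `&` (E1 `&` ((E2 `&` BY) `&`
    ((E3 `&` Be) `&` (E4 `&` BI))))); last by rewrite /setI; apply/seteqP; split=> w /=; tauto.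
rewrite !tmerw_indep5//; last 3 first.
- by apply: g_sigma_algebra_setI => //; exact: (sigma_process_rv _ hY).
- by apply: g_sigma_algebra_setI => //; exact: (sigma_process_rv _ he).
- by apply: g_sigma_algebra_setI => //; exact: (sigma_process_rv _ hI).
rewrite (indep_seq_split _ measurable_eq1 (tmerw_Y_indep HX) hY).
rewrite (indep_seq_split _ measurable_eq1 (tmerw_eps_indep HX) he).
rewrite (indep_seq_split _ mI (tmerw_I_indep HX) hI).
rewrite -/E2 -/E3 -/E4.
move: (P E0) (P E1) (P E2) (P E3) (P E4) (P BY) (P Be) (P BI) => e0 e1 e2 e3 e4 y e i.
by rewrite (muleACA e3) (muleACA e2) (muleA e1) (muleA e0).
Qed.

Lemma sigma_rv_measurable d' (V : measurableType d') (f : T -> V) (B : set T) :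
  measurable_fun setT f -> sigma_rv f B -> measurable B.
Proof. by move=> mf [C mC <-]; exact: mf. Qed.

Lemma sigma_rv_setT d' (V : measurableType d') (f : T -> V) : sigma_rv f setT.
Proof. by exists setT => //; rewrite preimage_setT setTI. Qed.

Lemma fin_code_eq1 (Z : {RV P >-> R}) : fin_code (fun w => Z w == 1).
Proof.
apply: fin_code_bool; rewrite (_ : [set w | _] = Z @^-1` [set 1]).
  by rewrite -[_ @^-1` _]setTI; exact: measurable_funP.
by apply/seteqP; split=> w /= /eqP.
Qed.

Lemma fin_code_nat (f : T -> nat) n : measurable_fun setT f ->
  (forall w, (f w <= n)%N) -> fin_code f.
Proof.
move=> mf fn; split; last by move=> k; rewrite -[_ @^-1` _]setTI; exact: mf.
by apply: sub_finite_set (finite_II n.+1) => _ [w _ <-] /=; rewrite ltnS.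
Qed.

Lemma tmerw_D_le n w k : (1 <= n)%N -> k \in D n w -> (k <= n)%N.
Proof. by move=> n1 /(tmerw_D_sub HX n1)/andP[]. Qed.

Lemma fin_code_D n : (1 <= n)%N -> fin_code (D n).
Proof.
move=> n1; pose c w := [seq k \in D n w | k <- iota 0 n.+1].
have fc : fin_code c.
  by apply: fin_code_seq => k _; apply: fin_code_bool; exact: (tmerw_D_meas HX k n1).
pose g bs := [fset k in [seq k <- iota 0 n.+1 | nth false bs k]]%fset.
have gE bs k : (k \in g bs) = nth false bs k && (k <= n)%N.
  by rewrite /g inE mem_filter mem_iota add0n ltnS.
have -> : D n = g \o c.
  apply/funext => w; apply/fsetP => k; rewrite gE.
  have [kn|kn] := leqP k n; last first.
    by rewrite andbF; apply/negP => /(tmerw_D_le n1); rewrite leqNgt kn.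
  by rewrite andbT (nth_map 0%N) ?size_iota// nth_iota// add0n.
exact: fin_code_comp.
Qed.

Lemma fin_code_history n : fin_code (history n).
Proof.
do !apply: fin_code_pair; first exact: fin_code_eq1.
- by apply: fin_code_seq => k; rewrite mem_iota => /andP[k1 _]; exact: fin_code_D.
- by apply: fin_code_seq => k _; exact: fin_code_eq1.
- by apply: fin_code_seq => k _; exact: fin_code_eq1.
apply: fin_code_seq => k; rewrite mem_iota => /andP[k1 _].
apply: (@fin_code_nat _ k) => // w; case: k k1 => [|[|k]]// _.
by have /andP[_ /leqW] := tmerw_I_range HX w (ltn0Sn k).
Qed.

Lemma history_eqP n w w' : history n w = history n w' ->
  [/\ (X 1%N w == 1) = (X 1%N w' == 1),
      forall k, (1 <= k <= n)%N -> D k w = D k w',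
      forall k, (2 <= k <= n)%N -> (Y k w == 1) = (Y k w' == 1),
      forall k, (2 <= k <= n)%N -> (eps k w == 1) = (eps k w' == 1) &
      forall k, (2 <= k <= n)%N -> I k w = I k w'].
Proof.
have kI k : (2 <= k <= n)%N -> k \in iota 2 n.-1.
  by rewrite mem_iota; lia.
case=> e0 /eq_in_map e1 /eq_in_map e2 /eq_in_map e3 /eq_in_map e4; split => //.
- by move=> k kn; apply: e1; rewrite mem_iota add1n ltnS.
- by move=> k /kI; exact: e2.
- by move=> k /kI; exact: e3.
- by move=> k /kI; exact: e4.
Qed.

(** The histories form a filtration. *)
Lemma adapted_historyW m n A (f : T -> A) : (m <= n)%N ->
  adapted (history m) f -> adapted (history n) f.
Proof.
move=> mn af w w' /history_eqP[e0 e1 e2 e3 e4]; apply: af; rewrite /history e0.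
have kn k : (1 <= k)%N -> (k <= m)%N -> (1 <= k <= n)%N.
  by move=> -> /leq_trans; apply.
have k2 k : k \in iota 2 m.-1 -> (2 <= k <= n)%N.
  by rewrite mem_iota; lia.
congr (_, (_, (_, (_, _)))); apply/eq_in_map => k.
- by rewrite mem_iota add1n ltnS => /andP[k1 km]; apply: e1; exact: kn.
- by move/k2; exact: e2.
- by move/k2; exact: e3.
- by move/k2; exact: e4.
Qed.

Lemma history_step_indep n (f : T -> R) (BY Be BI : set T) :
  adapted (history n.+1) f ->
  sigma_rv (Y n.+2) BY -> sigma_rv (eps n.+2) Be -> sigma_rv (I n.+2) BI ->
  Ex P (fun w => f w * \1_(BY `&` (Be `&` BI)) w) =
  Ex P f * (fine (P BY) * (fine (P Be) * fine (P BI))).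
Proof.
move=> af hY he hI.
have mY : measurable BY by apply: sigma_rv_measurable hY; exact: measurable_funP.
have me : measurable Be by apply: sigma_rv_measurable he; exact: measurable_funP.
have mI : measurable BI by apply: sigma_rv_measurable hI; exact: measurable_funP.
have PB : P (BY `&` (Be `&` BI)) = (P BY * (P Be * P BI))%E.
  have h5 := @tmerw_indep5 setT setT BY Be BI.
  rewrite !setTI !probability_setT !mul1e in h5; apply: h5.
  - exact: sigma_rv_setT.
  - exact: g_sigma_algebra_setT.
  - exact: (sigma_process_rv _ hY).
  - exact: (sigma_process_rv _ he).
  - exact: (sigma_process_rv _ hI).
rewrite (Ex_adapted_indep (fin_code_history n.+1) af).
- by rewrite PB !fineM ?fin_numM ?fin_num_measure.
- by do 2?apply: measurableI.
- by move=> x; rewrite PB; exact: history_indep.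
Qed.

Definition pm1 (x : R) : R := if x == 1 then 1 else -1.

Lemma pm1E x : pm1 x = 2 * (x == 1)%:R - 1.
Proof. by rewrite /pm1; case: ifP => _; rewrite ?mulr1 ?mulr0; ring. Qed.

Lemma pm1_sqr x : pm1 x ^+ 2 = 1.
Proof. by rewrite /pm1; case: ifP => _; rewrite ?expr1n// sqrrN expr1n. Qed.

(** The recursion of the walk calls an arbitrary earlier index. To make it structural, it runs on
    the size of a table: [step_memory m] holds the steps 1 to [m + 1]. *)
Fixpoint step_memory (m k : nat) (w : T) : R :=
  if m is m'.+1 then
    if (k <= m)%N then step_memory m' k w
    else if I m.+1 w \notin D m w then pm1 (eps m.+1 w) * step_memory m' (I m.+1 w) w
    else pm1 (Y m.+1 w)
  else X 1%N w.

(* A version of [X] that takes the values 1 and -1 everywhere, whereas [Y] and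
   [eps] do so only almost surely. *)
Definition step (k : nat) (w : T) : R := step_memory k.-1 k w.

Lemma step_memoryE m k w : (1 <= k <= m.+1)%N -> step_memory m k w = step k w.
Proof.
elim: m => [|m IH]; first by case: k => [|[|k]].
move=> /andP[k1]; rewrite leq_eqVlt => /predU1P[->//|km] /=.
by rewrite -ltnS km IH// k1.
Qed.

Lemma step1 w : step 1 w = X 1%N w. Proof. by []. Qed.

Lemma stepS n w : (1 <= n)%N -> step n.+1 w =
  if I n.+1 w \notin D n w then pm1 (eps n.+1 w) * step (I n.+1 w) w
  else pm1 (Y n.+1 w).
Proof.
case: n => // n _; rewrite /step/= ltnn; case: ifP => // _.
by rewrite step_memoryE//; exact: tmerw_I_range HX _ _ _.
Qed.

Lemma step_sqr n w : (1 <= n)%N -> step n w ^+ 2 = 1.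
Proof.
elim/ltn_ind: n => -[//|[|n]] IH _.
  by rewrite step1; case: (tmerw_X1 HX w) => ->; rewrite ?expr1n// sqrrN expr1n.
rewrite stepS//; case: ifP => _; last exact: pm1_sqr.
have /andP[I1 In] := tmerw_I_range HX w (ltn0Sn n).
by rewrite exprMn pm1_sqr mul1r IH.
Qed.

Lemma step_norm n w : (1 <= n)%N -> `|step n w| = 1.
Proof.
move=> n1; apply/eqP; rewrite -(@pexpr_eq1 _ _ 2)//.
by rewrite -normrX step_sqr// normr1.
Qed.

Lemma adapted_step n k : (1 <= k <= n)%N -> adapted (history n) (step k).
Proof.
move=> kn w w' /history_eqP[e0 e1 e2 e3 e4].
elim/ltn_ind: k kn => -[//|[|k]] IH kn.
  rewrite !step1; move: e0.
  have m1 : (-1 == 1 :> R) = false by apply/negbTE/eqP; lra.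
  by case: (tmerw_X1 HX w) => ->; case: (tmerw_X1 HX w') => ->; rewrite ?eqxx ?m1.
rewrite !stepS// e4// e1; last by move: kn; lia.
have /andP[I1 In] := tmerw_I_range HX w' (ltn0Sn k).
rewrite /pm1 e2// e3//; case: ifP => // _; rewrite IH ?ltnS// I1/=.
by apply: (leq_trans In); apply: ltnW; case/andP: kn.
Qed.

Lemma adapted_D n k : (1 <= k <= n)%N -> adapted (history n) (D k).
Proof. by move=> kn w w' /history_eqP[_ e1 _ _ _]; exact: e1. Qed.

(* Conditional expectation of [step n.+1] given [history n]. *)
Definition drift (n : nat) (w : T) : R := n%:R^-1 *
  \sum_(1 <= k < n.+1) (if k \notin D n w then (2 * p - 1) * step k w else 2 * lambda - 1).

Lemma adapted_drift n : (1 <= n)%N -> adapted (history n) (drift n).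
Proof.
move=> n1 w w' ww'; congr (_ * _); apply: eq_big_nat => k /andP[k1 kn].
rewrite (adapted_D _ ww') ?n1//=.
by rewrite (@adapted_step n k _ w w')// k1.
Qed.

(** The contribution of the index [k] to the conditional mean, for [Z] equal to [eps] or [Y]:
    [1/(n+1)] is the chance to draw [k], and [2 q - 1] is the mean of [pm1 Z]. *)
Lemma Ex_step_pm1 n (f : T -> R) (Z : {RV P >-> R}) (q : R) k :
  adapted (history n.+1) f -> (1 <= k <= n.+1)%N ->
  P (Z @^-1` [set 1]) = q%:E ->
  (forall B, sigma_rv Z B -> Ex P (fun w => f w * \1_(B `&` (I n.+2 @^-1` [set k])) w) =
    Ex P f * (fine (P B) * fine (P (I n.+2 @^-1` [set k])))) ->
  Ex P (fun w => f w * \1_(I n.+2 @^-1` [set k]) w * pm1 (Z w)) =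
  Ex P f * (n.+1%:R^-1 * (2 * q - 1)).
Proof.
move=> af kn Zq ind.
have mI : measurable (I n.+2 @^-1` [set k]).
  by rewrite -[_ @^-1` _]setTI; exact: measurable_funP.
have mZ : measurable (Z @^-1` [set 1]).
  by rewrite -[_ @^-1` _]setTI; exact: measurable_funP.
have bf := adapted_bounded_rv (fin_code_history n.+1) af.
rewrite (_ : (fun w => _) = fun w =>
    2 * (f w * \1_(Z @^-1` [set 1] `&` (I n.+2 @^-1` [set k])) w) -
    f w * \1_(setT `&` (I n.+2 @^-1` [set k])) w); last first.
  apply/funext => w; rewrite setTI indicI/= pm1E [\1_(Z @^-1` _) w]indicE.
  rewrite (_ : (w \in Z @^-1` [set 1]) = (Z w == 1)); first by ring.
  by apply/idP/eqP => [|Zw]; rewrite inE.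
rewrite ExB; last 2 first.
- apply: bounded_rvM; first exact: bounded_rv_cst.
  by apply: bounded_rvM => //; apply: bounded_rv_indic; exact: measurableI.
- by apply: bounded_rvM => //; apply: bounded_rv_indic; exact: measurableI.
rewrite ExZ; last first.
  by apply: bounded_rvM => //; apply: bounded_rv_indic; exact: measurableI.
rewrite !ind; last 2 first.
- exact: sigma_rv_setT.
- by apply: sigma_rv_preimage; exact: measurable_set1.
rewrite Zq probability_setT (tmerw_I_law HX kn)/=; ring.
Qed.

(** The defining property of the conditional expectation, tested against functions of the past. *)
Lemma Ex_step_drift n (g : T -> R) : (1 <= n)%N -> adapted (history n) g ->
  Ex P (fun w => g w * step n.+1 w) = Ex P (fun w => g w * drift n w).
Proof.
case: n => // n _ ag.
have sI k : sigma_rv (I n.+2) (I n.+2 @^-1` [set k]) by exact: sigma_rv_preimage.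
have mI k : measurable (I n.+2 @^-1` [set k]).
  by apply: sigma_rv_measurable (sI k); exact: measurable_funP.
have mpm (Z : {RV P >-> R}) : bounded_rv (fun w => pm1 (Z w)).
  apply: (@adapted_bounded_rv _ _ _ _ (fun w => Z w == 1)); first exact: fin_code_eq1.
  by move=> w w'; rewrite /pm1 => ->.
(* On the event that [k] is drawn, [g] times the new step equals [ge k] times the sign of [eps] plus
   [gy k] times that of [Y]; both coefficients belong to the past. *)
pose ge k w := g w * (k \notin D n.+1 w)%:R * step k w.
pose gy k w := g w * (k \in D n.+1 w)%:R.
have age k : (1 <= k <= n.+1)%N -> adapted (history n.+1) (ge k).
  move=> kn w w' ww'; rewrite /ge (ag _ _ ww') (adapted_D _ ww') ?leqnn//.
  by rewrite (adapted_step kn ww').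
have agy k : adapted (history n.+1) (gy k).
  by move=> w w' ww'; rewrite /gy (ag _ _ ww') (adapted_D _ ww') ?leqnn.
have bge k : (1 <= k <= n.+1)%N -> bounded_rv (ge k).
  by move=> /age; apply: adapted_bounded_rv; exact: fin_code_history.
have bgy k : bounded_rv (gy k).
  exact: adapted_bounded_rv (fin_code_history _) (agy k).
rewrite (_ : (fun w => g w * step n.+2 w) = fun w => \sum_(k < n.+1)
    (ge k.+1 w * \1_(I n.+2 @^-1` [set k.+1]) w * pm1 (eps n.+2 w)
     + gy k.+1 w * \1_(I n.+2 @^-1` [set k.+1]) w * pm1 (Y n.+2 w))); last first.
  apply/funext => w.
  have /andP[I1 In] := tmerw_I_range HX w (ltn0Sn n).
  have Ip : (I n.+2 w).-1.+1 = I n.+2 w by rewrite prednK.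
  have Il : ((I n.+2 w).-1 < n.+1)%N by rewrite Ip.
  rewrite (bigD1 (Ordinal Il))//= big1 ?addr0 => [|k kI]; last first.
    rewrite indicE memNset ?mulr0 ?mul0r ?addr0//= => e.
    by move/eqP: kI; apply; apply/val_inj; rewrite /= e.
  rewrite indicE mem_set ?mulr1; last by rewrite /= Ip.
  rewrite Ip stepS// /ge /gy; case: ifP => /= h; first by rewrite (negbTE h)/=; ring.
  by rewrite (negbFE h)/=; ring.
rewrite (_ : (fun w => g w * drift n.+1 w) = fun w => \sum_(k < n.+1)
    (n.+1%:R^-1 * (2 * p - 1) * ge k.+1 w
     + n.+1%:R^-1 * (2 * lambda - 1) * gy k.+1 w)); last first.
  apply/funext => w; rewrite /drift big_add1/= big_mkord mulrCA mulr_sumr mulr_sumr.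
  apply: eq_bigr => k _; rewrite /ge /gy; case: ifP => /= h; first by rewrite (negbTE h)/=; ring.
  by rewrite (negbFE h)/=; ring.
have kn (k : 'I_n.+1) : (1 <= k.+1 <= n.+1)%N by rewrite /= ltn_ord.
have bI (k : nat) := bounded_rv_indic R (mI k).
rewrite !Ex_sum; last 2 first.
- move=> k; apply: bounded_rvD; apply: bounded_rvM; (exact: bounded_rv_cst || exact: bge || exact: bgy).
- move=> k; apply: bounded_rvD; apply: bounded_rvM; (exact: mpm || apply: bounded_rvM => //; exact: bge).
apply: eq_bigr => k _.
rewrite ExD; last 2 first.
- by apply: bounded_rvM; [apply: bounded_rvM => //; exact: bge|exact: mpm].
- by apply: bounded_rvM; [apply: bounded_rvM => //; exact: bgy|exact: mpm].
rewrite ExD; last 2 first.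
- by apply: bounded_rvM; [exact: bounded_rv_cst|exact: bge].
- by apply: bounded_rvM; [exact: bounded_rv_cst|exact: bgy].
rewrite !ExZ//; last exact: bge.
rewrite (@Ex_step_pm1 _ _ _ p)//; last 3 first.
- exact: age.
- by case: (tmerw_eps_law HX (isT : (2 <= n.+2)%N)).
- move=> B sB; have := history_step_indep (age _ (kn k)) (sigma_rv_setT _) sB (sI k.+1).
  by rewrite setTI => ->; rewrite probability_setT mul1r.
rewrite (@Ex_step_pm1 _ _ _ lambda)//; last 2 first.
- by case: (tmerw_Y_law HX (isT : (2 <= n.+2)%N)).
- move=> B sB; have := history_step_indep (agy k.+1) sB (sigma_rv_setT _) (sI k.+1).
  by rewrite setTI => ->; rewrite probability_setT mul1r.
by rewrite mulrC [X in _ + X]mulrC.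
Qed.

Lemma pm1_ae (Z : {RV P >-> R}) (q : R) :
  P (Z @^-1` [set 1]) = q%:E -> P (Z @^-1` [set -1]) = (1 - q)%:E ->
  \forall w \ae P, Z w = pm1 (Z w).
Proof.
have n11 : (1 : R) <> -1 by lra.
move=> Z1 ZN1.
have m1 : measurable (Z @^-1` [set 1]).
  by rewrite -[_ @^-1` _]setTI; exact: measurable_funP.
have mN1 : measurable (Z @^-1` [set -1]).
  by rewrite -[_ @^-1` _]setTI; exact: measurable_funP.
exists (~` (Z @^-1` [set 1] `|` Z @^-1` [set -1])); split.
- by apply: measurableC; exact: measurableU.
- rewrite probability_setC; last exact: measurableU.
  have dis : Z @^-1` [set 1] `&` Z @^-1` [set -1] = set0.
    by apply/seteqP; split=> // w /= [->].
  have -> : P (Z @^-1` [set 1] `|` Z @^-1` [set -1]) = (q%:E + (1 - q)%:E)%E.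
    by rewrite -Z1 -ZN1; exact: measureU.
  by rewrite -EFinD (addrC q) subrK subrr.
- move=> w /= Zw [] Zw'; apply: Zw; rewrite /pm1 Zw' ?eqxx//.
  by case: ifP => // /eqP.
Qed.

Lemma step_ae : \forall w \ae P, forall n, (1 <= n)%N -> X n w = step n w.
Proof.
have Yae : \forall w \ae P, forall n, Y n.+2 w = pm1 (Y n.+2 w).
  apply: ae_foralln => n.
  by have [h1 h2] := tmerw_Y_law HX (isT : (2 <= n.+2)%N); exact: pm1_ae h1 h2.
have eae : \forall w \ae P, forall n, eps n.+2 w = pm1 (eps n.+2 w).
  apply: ae_foralln => n.
  by have [h1 h2] := tmerw_eps_law HX (isT : (2 <= n.+2)%N); exact: pm1_ae h1 h2.
apply: filterS2 Yae eae => w hY he n.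
elim/ltn_ind: n => -[//|[//|n]] IH _.
rewrite (tmerw_step HX)// stepS// -hY -he; case: ifP => // _.
by have /andP[I1 In] := tmerw_I_range HX w (ltn0Sn n); rewrite IH.
Qed.

Definition walk_step n (w : T) : R := \sum_(1 <= k < n.+1) step k w.

Definition card_D n (w : T) : R := (#|` D n w|)%:R.

Lemma walk_stepS n w : walk_step n.+1 w = walk_step n w + step n.+1 w.
Proof. by rewrite /walk_step big_nat_recr. Qed.

Lemma walk_step_ae : \forall w \ae P, forall n, walk X n w = walk_step n w.
Proof.
apply: filterS step_ae => w h n.
have -> : walk X n w = \sum_(1 <= k < n.+1) X k w.
  by rewrite /walk; elim: index_iota => [|k l IH]; rewrite ?big_nil// !big_cons -IH.
by apply: eq_big_nat => k /andP[k1 _]; exact: h.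
Qed.

Lemma walk_step_le n w : `|walk_step n w| <= n%:R.
Proof.
apply: (le_trans (ler_norm_sum _ _ _)).
rewrite (@eq_big_nat _ _ _ _ _ _ (fun=> 1)); last first.
  by move=> k /andP[k1 _]; exact: step_norm.
by rewrite sumr_const_nat subn1.
Qed.

Lemma adapted_walk_step n : adapted (history n) (walk_step n).
Proof.
move=> w w' ww'; apply: eq_big_nat => k /andP[k1 kn].
by rewrite (@adapted_step n k _ w w')// k1.
Qed.

Lemma adapted_card_D n : (1 <= n)%N -> adapted (history n) (card_D n).
Proof. by move=> n1 w w' ww'; rewrite /card_D (adapted_D _ ww')// n1 leqnn. Qed.

Lemma card_D_ge0 n w : 0 <= card_D n w. Proof. by []. Qed.

Lemma card_D_le n w : (1 <= n)%N -> card_D n w <= n%:R.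
Proof.
move=> n1; rewrite ler_nat -[leqRHS](size_iota 1).
apply: uniq_leq_size; first exact: fset_uniq.
by move=> k kD; rewrite mem_iota add1n ltnS; exact: tmerw_D_sub HX n w k n1 kD.
Qed.

Hypotheses (p01 : 0 <= p <= 1) (lambda01 : 0 <= lambda <= 1).

Lemma norm_double_sub1_le (q : R) : 0 <= q <= 1 -> `|2 * q - 1| <= 1.
Proof. by move=> /andP[q0 q1]; rewrite ler_norml; apply/andP; split; lra. Qed.

Lemma drift_norm_le1 n w : (1 <= n)%N -> `|drift n w| <= 1.
Proof.
move=> n1; rewrite /drift normrM normfV normr_nat ler_pdivrMl ?ltr0n// mulr1.
apply: (le_trans (ler_norm_sum _ _ _)).
rewrite -[leRHS](_ : \sum_(1 <= k < n.+1) 1 = _); last first.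
  by rewrite sumr_const_nat subn1.
apply: ler_sum_nat => k /andP[k1 _]; case: ifP => _.
  by rewrite normrM step_norm// mulr1 norm_double_sub1_le.
exact: norm_double_sub1_le.
Qed.

(** Only the indices in [D n w] contribute to the difference, each by at most
    [|2 lambda - 1| + |2 p - 1| <= 2]. *)
Lemma drift_walk_le n w : (1 <= n)%N ->
  `|drift n w - (2 * p - 1) * walk_step n w / n%:R| <= 2 * card_D n w / n%:R.
Proof.
move=> n1; rewrite /drift mulrC -mulrBl normrM normfV normr_nat.
rewrite ler_wpM2r ?invr_ge0// mulr_sumr -sumrB.
apply: (le_trans (ler_norm_sum _ _ _)).
apply: (@le_trans _ _ (\sum_(1 <= k < n.+1) 2 * (k \in D n w)%:R)).
  apply: ler_sum_nat => k /andP[k1 _]; case: ifP => /= h.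
    by rewrite (negbTE h) subrr normr0 mulr0.
  rewrite (negbFE h) mulr1; apply: (le_trans (ler_normB _ _)).
  rewrite normrM step_norm// mulr1; apply: (@le_trans _ _ (1 + 1)); last by lra.
  by apply: lerD; exact: norm_double_sub1_le.
rewrite -mulr_sumr ler_wpM2l// -natr_sum ler_nat -big_mkcond/= sum1_count.
rewrite -size_filter; apply: uniq_leq_size; first by rewrite filter_uniq ?iota_uniq.
by move=> k; rewrite mem_filter => /andP[].
Qed.

End History.

Lemma Ex_bounded_cvg0 d (T : measurableType d) (R : realType) (P : probability T R)
    (f : nat -> T -> R) (C : R) :
  (forall n, measurable_fun setT (f n)) -> (forall n w, `|f n w| <= C) ->
  (\forall w \ae P, f n w @[n --> \oo] --> 0) ->
  Ex P (f n) @[n --> \oo] --> 0.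
Proof.
move=> mf fC f0.
have [|||||_ _] := @dominated_convergence _ T R P setT measurableT
  (fun n w => (f n w)%:E) (fun=> 0%E) (fun=> C%:E).
- by move=> n; apply/measurable_EFinP.
- exact: measurable_cst.
- by apply: filterS f0 => w fw _; apply: cvg_EFin => //; near=> n.
- exact: (bounded_rv_integrable P (@bounded_rv_cst _ T R C)).
- by apply: aeW => w n _; rewrite lee_fin.
by rewrite integral0 => /fine_cvg.
Unshelve. all: by end_near. Qed.

Lemma norm_squeeze_cvg0 (R : realType) (x y : nat -> R) :
  (\forall n \near \oo, `|x n| <= y n) -> y n @[n --> \oo] --> 0 ->
  x n @[n --> \oo] --> 0.
Proof.
move=> xy y0; have yN0 : - y n @[n --> \oo] --> 0 by rewrite -oppr0; exact: cvgN.
apply: (squeeze_cvgr _ yN0 y0); apply: filterS xy => n.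
by rewrite ler_norml.
Qed.

Lemma cvg_continuous_comp (R : realType) (h : R -> R) (x : nat -> R) (l : R) :
  {for l, continuous h} -> x n @[n --> \oo] --> l -> h (x n) @[n --> \oo] --> h l.
Proof. by move=> hl xl; exact: (cvg_comp _ _ xl hl). Qed.

(** * Martingale decomposition and central limit theorem *)

Section Martingale.
Context d (T : measurableType d) (R : realType) (P : probability T R).
Context (p lambda : R) (D : nat -> T -> {fset nat}).
Context (X Y eps : nat -> {RV P >-> R}) (I : nat -> {RV P >-> nat}).
Hypothesis HX : TMERW P p lambda D X Y eps I.
Hypotheses (p01 : 0 <= p <= 1) (lambda01 : 0 <= lambda <= 1).
Local Notation a := (2 * p - 1).
Local Notation u := (weight a).
Local Notation history := (history D X Y eps I).
Local Notation step := (step D X Y eps I).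
Local Notation drift := (drift p lambda D X Y eps I).
Local Notation walk_step := (walk_step D X Y eps I).
Local Notation card_D := (@card_D _ _ R D).

Lemma exponent_bounds : -1 <= a <= 1.
Proof. by have /andP[? ?] := p01; apply/andP; split; lra. Qed.

Lemma history_bounded_rv n (f : T -> R) : adapted (history n) f -> bounded_rv f.
Proof. by move=> af; apply: adapted_bounded_rv af; exact: fin_code_history HX n. Qed.

Definition noise n (w : T) : R := step n w - drift n.-1 w.

Definition mart n (w : T) : R := \sum_(1 <= j < n) u j.+1 * noise j.+1 w.

(** The leading 1 is the absolute value of the first step; the sum collects the bounds of
    [err_step]. Randomness enters through [D] alone. *)
Definition err_bound n (w : T) : R :=
  1 + \sum_(1 <= j < n) 4 * (u j.+1 * (1 + card_D j w) / j.+1%:R).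

Lemma martS n w : (1 <= n)%N -> mart n.+1 w = mart n w + u n.+1 * noise n.+1 w.
Proof. by move=> n1; rewrite /mart big_nat_recr. Qed.

Lemma err_boundS n w : err_bound n.+1 w =
  1 + \sum_(0 <= j < n) 4 * (u j.+2 * (1 + card_D j.+1 w) / j.+2%:R).
Proof. by rewrite /err_bound big_add1. Qed.

Local Notation err n w := (u n * walk_step n w - mart n w).

(** Two errors add up: the defect of the weights, of order [u / n^2], times [|S_n| <= n]; and the
    effect of tampering, bounded by [drift_walk_le]. *)
Lemma err_step n w : (1 <= n)%N ->
  `|err n.+1 w - err n w| <= 4 * (u n.+1 * (1 + card_D n w) / n.+1%:R).
Proof.
case: n => // n _; set m := n.+1.
have m0 : 0 < m%:R :> R by rewrite ltr0n.
have -> : err m.+1 w - err m w =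
    (u m.+1 * (1 + a / m%:R) - u m) * walk_step m w
     + u m.+1 * (drift m w - a * walk_step m w / m%:R).
  rewrite /mart (@big_nat_recr _ _ _ m)//= walk_stepS /noise/=.
  by field; rewrite gt_eqF.
have u0 : 0 <= u m.+1 := weight_ge0 _ _.
(* This doubling, with the one of [weight_le_double] or the 2 in [drift_walk_le], makes the constant
   4. *)
have hm : m%:R^-1 <= 2 / m.+1%:R :> R.
  rewrite ler_pdivlMr ?ltr0n// mulrC ler_pdivrMr//.
  by rewrite -natrM ler_nat mul2n -addnn -addn1 leq_add2l.
apply: (le_trans (ler_normD _ _)).
rewrite (_ : 4 * _ = u m.+1 * 4 / m.+1%:R + u m.+1 * 4 * card_D m w / m.+1%:R); last by ring.
apply: lerD.
  rewrite normrM.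
  have h1 := weight_drift exponent_bounds (isT : (1 <= m)%N).
  have h2 := weight_le_double exponent_bounds (isT : (1 <= m)%N).
  have h3 := walk_step_le HX m w.
  apply: (@le_trans _ _ (u m * m%:R^-1 ^+ 2 * m%:R)); first exact: ler_pM.
  rewrite expr2 -!mulrA mulVf ?gt_eqF// mulr1.
  apply: (@le_trans _ _ (2 * u m.+1 * (2 / m.+1%:R))).
    by apply: ler_pM => //; exact: weight_ge0.
  by rewrite le_eqVlt; apply/orP; left; apply/eqP; ring.
rewrite normrM (ger0_norm u0) -!mulrA ler_wpM2l//.
have := drift_walk_le HX p01 lambda01 w (isT : (1 <= m)%N).
rewrite -(mulrA a) => /le_trans; apply.
have := ler_wpM2l (card_D_ge0 R D m w) hm.
by move: (card_D m w) (m%:R^-1) (m.+1%:R^-1) => c x y; lra.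
Qed.

Lemma walk_decomposition n w : (1 <= n)%N -> `|err n w| <= err_bound n w.
Proof.
elim: n => // -[|n] IH _.
  rewrite /mart /err_bound !big_geq// subr0 addr0 normrM /walk_step big_nat1.
  by rewrite (step_norm HX)// /weight powR1 normr1 mulr1.
apply: (@le_trans _ _ (`|err n.+1 w| + `|err n.+2 w - err n.+1 w|)).
  by have := ler_normD (err n.+1 w) (err n.+2 w - err n.+1 w); rewrite addrC subrK.
rewrite /err_bound big_nat_recr//= addrA.
by apply: lerD; [exact: IH|exact: err_step].
Qed.

Lemma noise_le n w : (1 <= n)%N -> `|noise n.+1 w| <= 2.
Proof.
move=> n1; apply: (le_trans (ler_normB _ _)); rewrite (step_norm HX)//.
by have := drift_norm_le1 HX p01 lambda01 w n1; rewrite /=; lra.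
Qed.

Lemma adapted_noise n : (1 <= n)%N -> adapted (history n.+1) (noise n.+1).
Proof.
move=> n1 w w' ww'; rewrite /noise/= (adapted_step HX _ ww') ?leqnn//.
by rewrite (adapted_historyW (leqnSn n) (adapted_drift HX n1) ww').
Qed.

Lemma adapted_mart n : adapted (history n) (mart n).
Proof.
move=> w w' ww'; apply: eq_big_nat => j /andP[j1 jn].
by rewrite (adapted_historyW jn (adapted_noise j1) ww').
Qed.

Lemma Ex_noise n (g : T -> R) : (1 <= n)%N -> adapted (history n) g ->
  Ex P (fun w => noise n.+1 w * g w) = 0.
Proof.
move=> n1 ag; have bg := history_bounded_rv ag.
have bs : bounded_rv (step n.+1).
  by apply: (@history_bounded_rv n.+1); apply: (adapted_step HX); rewrite leqnn.
have bd := history_bounded_rv (adapted_drift HX n1).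
rewrite (_ : (fun w => _) = fun w => g w * step n.+1 w - g w * drift n w); last first.
  by apply/funext => w; rewrite /noise/=; ring.
rewrite ExB; [|exact: bounded_rvM|exact: bounded_rvM].
by rewrite (Ex_step_drift HX n1 ag) subrr.
Qed.

(** As the step has square 1, [noise^2 - 1] equals [- 2 noise * drift - drift^2], whose first term
    has conditional mean 0. *)
Lemma Ex_noise_sqr n (g : T -> R) : (1 <= n)%N -> adapted (history n) g ->
  Ex P (fun w => (noise n.+1 w ^+ 2 - 1) * g w) = - Ex P (fun w => drift n w ^+ 2 * g w).
Proof.
move=> n1 ag.
have ad := adapted_drift HX n1.
have adg : adapted (history n) (fun w => drift n w * g w).
  by move=> w w' ww'; rewrite (ad _ _ ww') (ag _ _ ww').
have addg : adapted (history n) (fun w => drift n w ^+ 2 * g w).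
  by move=> w w' ww'; rewrite (ad _ _ ww') (ag _ _ ww').
have bn := history_bounded_rv (adapted_noise n1).
rewrite (_ : (fun w => _) = fun w => -2 * (noise n.+1 w * (drift n w * g w))
   - drift n w ^+ 2 * g w); last first.
  apply/funext => w; have := step_sqr HX w (ltn0Sn n); rewrite /noise/= => s2.
  by rewrite -[1 in LHS]s2; ring.
have bng := bounded_rvM bn (history_bounded_rv adg).
rewrite ExB; [|apply: bounded_rvM; [exact: bounded_rv_cst|exact: bng]|exact: history_bounded_rv addg].
by rewrite ExZ// Ex_noise// mulr0 sub0r.
Qed.

(** Average [gauss_cdf_heat_step] with [q = c - Z], a function of the past: the first-order term has
    mean 0, and the second-order one leaves only the squared drift. *)
Lemma lindeberg_step (k : R) (G : R -> R) n (Z : T -> R) (t b c : R) :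
  0 <= k -> (forall x : R, is_derive x 1 G (gauss_density k x)) ->
  (1 <= n)%N -> adapted (history n) Z -> 0 < t -> 0 <= b ->
  `|Ex P (fun w => G ((c - (Z w + b * noise n.+1 w)) / Num.sqrt t))
    - Ex P (fun w => G ((c - Z w) / Num.sqrt (t + b ^+ 2)))| <=
  24 * k / Num.sqrt t ^+ 3 * b ^+ 3 + 9 * k / t ^+ 2 * b ^+ 4
  + b ^+ 2 * (k / t) * Ex P (fun w => drift n w ^+ 2).
Proof.
move=> k0 dG n1 aZ t0 b0; set K := _ + _ * b ^+ 4.
have aN := adapted_noise n1.
have aZ' := adapted_historyW (leqnSn n) aZ.
have ad := adapted_drift HX n1.
pose z w := (c - Z w) / Num.sqrt t.
pose A w := gauss_density k (z w) / Num.sqrt t.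
pose B w := z w * gauss_density k (z w) / t.
pose G1 w := G ((c - (Z w + b * noise n.+1 w)) / Num.sqrt t).
pose G0 w := G ((c - Z w) / Num.sqrt (t + b ^+ 2)).
have az : adapted (history n) z by move=> w w' ww'; rewrite /z (aZ _ _ ww').
have aA : adapted (history n) A by move=> w w' ww'; rewrite /A (az _ _ ww').
have aB : adapted (history n) B by move=> w w' ww'; rewrite /B (az _ _ ww').
have bG1 : bounded_rv G1.
  by apply: (@history_bounded_rv n.+1) => w w' ww'; rewrite /G1 (aZ' _ _ ww') (aN _ _ ww').
have bG0 : bounded_rv G0.
  by apply: (@history_bounded_rv n) => w w' ww'; rewrite /G0 (aZ _ _ ww').
have bA := history_bounded_rv aA; have bB := history_bounded_rv aB.
have bN := history_bounded_rv aN.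
have bNA := bounded_rvM bN bA.
have bNB : bounded_rv (fun w => (noise n.+1 w ^+ 2 - 1) * B w).
  apply: (@history_bounded_rv n.+1) => w w' ww'.
  by rewrite (aN _ _ ww') (adapted_historyW (leqnSn n) aB ww').
have bcNA : bounded_rv (fun w => b * (noise n.+1 w * A w)).
  by apply: bounded_rvM; [exact: bounded_rv_cst|exact: bNA].
have bcNB : bounded_rv (fun w => b ^+ 2 / 2 * ((noise n.+1 w ^+ 2 - 1) * B w)).
  by apply: bounded_rvM; [exact: bounded_rv_cst|exact: bNB].
have bH := bounded_rvD (bounded_rvD (bounded_rvB bG1 bG0) bcNA) bcNB.
have : `|Ex P (fun w => G1 w - G0 w + b * (noise n.+1 w * A w)
    + b ^+ 2 / 2 * ((noise n.+1 w ^+ 2 - 1) * B w))| <= K.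
  apply: (le_trans (Ex_norm_le P bH)); rewrite -[leRHS](Ex_cst P).
  apply: Ex_le; [|exact: bounded_rv_cst|].
    split; first by apply: measurableT_comp => //; case: bH.
    by case: bH => _ [C hC]; exists C => w; rewrite normr_id.
  move=> w; have := gauss_cdf_heat_step k0 dG (c - Z w) t0 b0 (noise_le w n1).
  by rewrite /G1 opprD addrA.
rewrite (ExD P (bounded_rvD (bounded_rvB bG1 bG0) bcNA) bcNB).
rewrite (ExD P (bounded_rvB bG1 bG0) bcNA) (ExB P bG1 bG0) (ExZ P _ bNA) (ExZ P _ bNB).
rewrite (Ex_noise n1 aA) mulr0 addr0 (Ex_noise_sqr n1 aB).
have adB : adapted (history n) (fun w => drift n w ^+ 2 * B w).
  by move=> w w' ww'; rewrite (ad _ _ ww') (aB _ _ ww').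
have bd2 : bounded_rv (fun w => drift n w ^+ 2).
  by apply: (@history_bounded_rv n) => w w' ww'; rewrite (ad _ _ ww').
have bdB := history_bounded_rv adB.
have : `|Ex P (fun w => drift n w ^+ 2 * B w)| <= 2 * k / t * Ex P (fun w => drift n w ^+ 2).
  apply: (le_trans (Ex_norm_le P bdB)); rewrite -ExZ//; apply: Ex_le.
  - split; first by apply: measurableT_comp => //; case: bdB.
    by case: bdB => _ [C hC]; exists C => w; rewrite normr_id.
  - by apply: bounded_rvM; [exact: bounded_rv_cst|exact: bd2].
  move=> w; rewrite normrM ger0_norm ?sqr_ge0// mulrC ler_wpM2r ?sqr_ge0//.
  rewrite /B normrM (ger0_norm (_ : 0 <= t^-1)) ?invr_ge0 ?(ltW t0)//.
  by rewrite ler_wpM2r ?invr_ge0 ?(ltW t0)// abs_gauss_density_le.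
move: (Ex P (fun w => drift n w ^+ 2 * B w)) (Ex P (fun w => drift n w ^+ 2)) => DB DD hDB.
move: (Ex P G1) (Ex P G0) => g1 g0 hg.
have -> : g1 - g0 = (g1 - g0 + b ^+ 2 / 2 * - DB) + b ^+ 2 / 2 * DB by ring.
apply: (le_trans (ler_normD _ _)); apply: lerD => //.
have b2 : 0 <= b ^+ 2 / 2 by rewrite divr_ge0 ?sqr_ge0.
rewrite normrM (ger0_norm b2).
apply: (le_trans (ler_wpM2l b2 hDB)).
by rewrite le_eqVlt; apply/orP; left; apply/eqP; field; rewrite gt_eqF.
Qed.

Lemma bounded_rv_card_D n : (1 <= n)%N -> bounded_rv (card_D n).
Proof. by move=> n1; apply: (@history_bounded_rv n); exact: adapted_card_D. Qed.

Hypothesis HD : \forall w \ae P, card_D n w / n%:R @[n --> \oo] --> (0 : R).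

Lemma Ex_card_D_cvg0 : Ex P (fun w => card_D n w / n%:R) @[n --> \oo] --> (0 : R).
Proof.
(* The shift avoids index 0, where [D] is unconstrained. *)
rewrite -(cvg_shiftS (fun n => Ex P (fun w => card_D n w / n%:R))).
apply: (@Ex_bounded_cvg0 _ _ _ _ (fun n w => card_D n.+1 w / n.+1%:R) 1).
- move=> n; apply: measurable_funM => //.
  by case: (bounded_rv_card_D (ltn0Sn n)).
- move=> n w; rewrite ger0_norm ?divr_ge0// ler_pdivrMr ?ltr0n// mul1r.
  exact: (card_D_le HX).
by apply: filterS HD => w; rewrite -(cvg_shiftS (fun n => card_D n w / n%:R)).
Qed.

(** Expanding the square gives [E S_n^2 + 2 E (S_n * drift) + 1]. Up to tampering, the middle term
    is [2 a / n] times [E S_n^2], at most [1/n] times it; tampering costs [4 E |D_n|] because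
    [|S_n| <= n]. *)
Lemma Ex_walk_sqr_cvg0 : a <= 1 / 2 ->
  Ex P (fun w => walk_step n w ^+ 2) / n%:R ^+ 2 @[n --> \oo] --> (0 : R).
Proof.
move=> a2.
have bS n : bounded_rv (fun w => walk_step n w ^+ 2).
  apply: (@history_bounded_rv n) => w w' ww'.
  by rewrite (adapted_walk_step HX ww').
apply: (@sqr_growth_cvg0 _ _ (fun n => 4 * Ex P (card_D n) + 1)).
- by move=> n; apply: Ex_ge0 => w; exact: sqr_ge0.
- move=> n n1.
  have aS := @adapted_walk_step _ _ _ _ _ _ _ _ _ _ _ HX n.
  have bS' := history_bounded_rv aS.
  have bX : bounded_rv (step n.+1).
    by apply: (@history_bounded_rv n.+1); apply: (adapted_step HX); rewrite leqnn.
  have bd := history_bounded_rv (adapted_drift HX n1).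
  have bD := bounded_rv_card_D n1.
  rewrite (_ : (fun w => walk_step n.+1 w ^+ 2) = fun w =>
      (walk_step n w ^+ 2 + 2 * (walk_step n w * step n.+1 w)) + 1); last first.
    apply/funext => w; have := step_sqr HX w (ltn0Sn n) => s2.
    rewrite walk_stepS; transitivity (walk_step n w ^+ 2 + 2 * (walk_step n w * step n.+1 w)
      + step n.+1 w ^+ 2); [by ring|by rewrite s2].
  have b2 (f : T -> R) (c : R) : bounded_rv f -> bounded_rv (fun w => c * f w).
    by move=> bf; apply: bounded_rvM => //; exact: bounded_rv_cst.
  rewrite ExD; [|by apply: bounded_rvD => //; apply: (b2); exact: bounded_rvM|exact: bounded_rv_cst].
  rewrite ExD; [|exact: bS|by apply: (b2); exact: bounded_rvM].
  rewrite ExZ; last exact: bounded_rvM.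
  rewrite (Ex_step_drift HX n1 aS) Ex_cst.
  have : Ex P (fun w => walk_step n w * drift n w) <=
      Ex P (fun w => (2^-1 / n%:R) * walk_step n w ^+ 2 + 2 * card_D n w).
    apply: Ex_le; [exact: bounded_rvM| by apply: bounded_rvD; apply: (b2)|].
    move=> w; have n0 : 0 < n%:R :> R by rewrite ltr0n.
    have := drift_walk_le HX p01 lambda01 w n1; have := walk_step_le HX n w.
    set s := walk_step n w; set c := card_D n w; set e := drift n w => sn er.
    have -> : s * e = a * (s ^+ 2 / n%:R) + s * (e - a * s / n%:R) by ring.
    apply: lerD.
      have -> : 2^-1 / n%:R * s ^+ 2 = 2^-1 * (s ^+ 2 / n%:R) by ring.
      by rewrite ler_wpM2r ?divr_ge0 ?sqr_ge0//; lra.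
    apply: (le_trans (ler_norm _)); rewrite normrM.
    apply: (@le_trans _ _ (n%:R * (2 * c / n%:R))); first exact: ler_pM.
    by rewrite le_eqVlt; apply/orP; left; apply/eqP; field; rewrite gt_eqF.
  rewrite ExD; [|exact: (b2)|exact: (b2)].
  rewrite !ExZ// => H.
  move: (Ex P _) (Ex P _) (Ex P _) H => e1 e2 e3 H.
  rewrite mulrDl mul1r; lra.
have Vn : n%:R^-1 @[n --> \oo] --> (0 : R).
  apply/gtr0_cvgV0; last exact: cvgr_idn.
  by near=> n; rewrite ltr0n; near: n; exact: nbhs_infty_gt.
have : 4 * Ex P (fun w => card_D n w / n%:R) + n%:R^-1 @[n --> \oo] --> (4 * 0 + 0 : R).
  by apply: cvgD => //; apply: cvgM; [exact: cvg_cst|exact: Ex_card_D_cvg0].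
rewrite mulr0 addr0; apply: cvg_trans; apply: near_eq_cvg; near=> n.
have n1 : (1 <= n)%N by near: n; exact: nbhs_infty_ge.
have -> : (fun w => card_D n w / n%:R) = (fun w => n%:R^-1 * card_D n w).
  by apply/funext => w; rewrite mulrC.
by rewrite (ExZ P _ (bounded_rv_card_D n1)); ring.
Unshelve. all: by end_near. Qed.

(** The squared drift is at most [2 (S_n/n)^2 + 8 |D_n|/n]: since [|D_n|/n <= 1], its square is
    bounded by itself and a first moment suffices. *)
Lemma Ex_drift_sqr_cvg0 : a <= 1 / 2 ->
  Ex P (fun w => drift n w ^+ 2) @[n --> \oo] --> (0 : R).
Proof.
move=> a2; have [am1 _] := andP exponent_bounds.
have h : 2 * (Ex P (fun w => walk_step n w ^+ 2) / n%:R ^+ 2) +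
    8 * Ex P (fun w => card_D n w / n%:R) @[n --> \oo] --> (2 * 0 + 8 * 0 : R).
  apply: cvgD; apply: cvgM; (exact: cvg_cst || exact: Ex_walk_sqr_cvg0 || exact: Ex_card_D_cvg0).
rewrite !mulr0 addr0 in h.
apply: (squeeze_cvgr _ (cvg_cst 0) h); near=> n; rewrite Ex_ge0/=; last by move=> w; exact: sqr_ge0.
have n1 : (1 <= n)%N by near: n; exact: nbhs_infty_ge.
have n0 : 0 < n%:R :> R by rewrite ltr0n.
have bS : bounded_rv (fun w => walk_step n w ^+ 2).
  apply: (@history_bounded_rv n) => w w' ww'.
  by rewrite (adapted_walk_step HX ww').
have bd : bounded_rv (fun w => drift n w ^+ 2).
  apply: (@history_bounded_rv n) => w w' ww'.
  by rewrite (adapted_drift HX n1 ww').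
have bD : bounded_rv (fun w => card_D n w / n%:R).
  by apply: bounded_rvM; [exact: bounded_rv_card_D|exact: bounded_rv_cst].
have b2 (f : T -> R) (c : R) : bounded_rv f -> bounded_rv (fun w => c * f w).
  by move=> bf; apply: bounded_rvM => //; exact: bounded_rv_cst.
rewrite mulrA [_ / n%:R ^+ 2]mulrC mulrA -ExZ// -ExZ// -ExD; [|exact: b2|exact: b2].
apply: Ex_le => //; first by apply: bounded_rvD; exact: b2.
move=> w.
have := drift_walk_le HX p01 lambda01 w n1.
have := card_D_le HX w n1; have := card_D_ge0 R D n w.
set s := walk_step n w; set c := card_D n w; set e := drift n w => c0 cn er.
have q1 : c / n%:R <= 1 by rewrite ler_pdivrMr// mul1r.
have q0 : 0 <= c / n%:R by rewrite divr_ge0.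
have -> : (n%:R ^+ 2)^-1 * 2 * s ^+ 2 = 2 * (s / n%:R) ^+ 2 by field; rewrite gt_eqF.
move: er; rewrite -!mulrA; set q := c / n%:R in q0 q1 *; set t := s / n%:R.
rewrite ler_norml => /andP[e1 e2].
have h1 : (e - a * t) ^+ 2 <= 4 * q.
  have : (e - a * t) ^+ 2 <= (2 * q) ^+ 2.
    by rewrite -[leLHS]real_normK ?num_real// lerXn2r ?nnegrE ?ler_norml ?mulr_ge0// e1 e2.
  nra.
have h2 : (a * t) ^+ 2 <= t ^+ 2.
  by rewrite exprMn ler_piMl ?sqr_ge0//; nra.
have := sqr_ge0 (a * t - (e - a * t)); nra.
Unshelve. all: by end_near. Qed.

(** * Lindeberg replacement and removal of the smoothing *)

Section Clt.
Hypothesis a2 : a <= 1 / 2.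
Variables (k : R) (G : R -> R).
Hypothesis k0 : 0 <= k.
Hypothesis dG : forall x : R, is_derive x 1 G (gauss_density k x).
Hypothesis G01 : forall x, 0 <= G x <= 1.
Hypothesis G_homo : {homo G : x y / x <= y}.
Hypothesis G_tails : forall e, 0 < e ->
  exists K : R, [/\ 0 < K, 1 - e <= G K & G (- K) <= e].
Variable rho : nat -> R.
Hypothesis rho0 : forall n, 0 <= rho n.
Hypothesis rho_cvg0 : rho n @[n --> \oo] --> 0.
Hypothesis rho_weight_cvg0 : rho n * u n @[n --> \oo] --> 0.
Local Notation V n := (rho n ^+ 2 * \sum_(1 <= j < n) u j.+1 ^+ 2).
Hypothesis variance_cvg1 : V n @[n --> \oo] --> (1 : R).
(** With the truncation, one condition serves both regimes: it follows from convergence in mean as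
    well as, by bounded convergence, from almost sure convergence. *)
Hypothesis err_cvg0 :
  Ex P (fun w => Num.min 1 (rho n * err_bound n w)) @[n --> \oo] --> 0.

(** The weights increase if [a <= 0] and are at most 1 if [a > 0]; the sum covers both signs. *)
Lemma weight_le_sum m n : (1 <= m <= n)%N -> u m <= 1 + u n.
Proof.
move=> /andP[m1 mn]; have [an|ap] := leP 0 (- a).
  apply: ler_wpDl => //; rewrite /weight.
  by rewrite ge0_ler_powR ?nnegrE ?ler0n ?ler_nat.
apply: ler_wpDr; first exact: weight_ge0.
have := @ler_powR R m%:R _ _ _ (ltW ap); rewrite powRr0; apply.
by rewrite ler1n.
Qed.

Lemma lindeberg_sum (t0 c : R) (n : nat) : 0 < t0 -> (1 <= n)%N ->
  `|Ex P (fun w => G ((c - rho n * mart n w) / Num.sqrt t0))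
    - G (c / Num.sqrt (t0 + V n))| <=
  (24 * k / Num.sqrt t0 ^+ 3 * (rho n * (1 + u n))
    + 9 * k / t0 ^+ 2 * (rho n * (1 + u n)) ^+ 2) * V n
  + k / t0 * (rho n ^+ 2 * \sum_(1 <= j < n) u j.+1 ^+ 2 * Ex P (fun w => drift j w ^+ 2)).
Proof.
move=> t00 n1; set r := rho n; set m := r * _.
have m0 : 0 <= m by rewrite mulr_ge0 ?rho0 ?addr_ge0 ?weight_ge0.
(* [tau l] is the smoothing variance plus that of the increments still Gaussian. Thus [psi]
   interpolates between [psi 1], fully Gaussian and deterministic, and [psi n], the smoothed law of
   the martingale. *)
pose tau l := t0 + r ^+ 2 * \sum_(l <= j < n) u j.+1 ^+ 2.
have sum0 l : 0 <= \sum_(l <= j < n) u j.+1 ^+ 2 by apply: sumr_ge0 => j _; exact: sqr_ge0.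
have tau_ge l : t0 <= tau l by rewrite /tau lerDl mulr_ge0 ?sqr_ge0.
pose psi l := Ex P (fun w => G ((c - r * mart l w) / Num.sqrt (tau l))).
pose C1 := 24 * k / Num.sqrt t0 ^+ 3; pose C2 := 9 * k / t0 ^+ 2.
have s0 : 0 < Num.sqrt t0 by rewrite sqrtr_gt0.
have C10 : 0 <= C1 by rewrite divr_ge0 ?mulr_ge0 ?exprn_ge0// ltW.
have C20 : 0 <= C2 by rewrite divr_ge0 ?mulr_ge0 ?exprn_ge0// ltW.
pose E j := (C1 * m + C2 * m ^+ 2) * (r ^+ 2 * u j.+1 ^+ 2) +
  k / t0 * (r ^+ 2 * (u j.+1 ^+ 2 * Ex P (fun w => drift j w ^+ 2))).
have psiS l : (1 <= l < n)%N -> `|psi l.+1 - psi l| <= E l.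
  move=> /andP[l1 ln]; pose b := r * u l.+1.
  have b0 : 0 <= b by rewrite mulr_ge0 ?rho0 ?weight_ge0.
  have bm : b <= m by rewrite ler_wpM2l ?rho0// weight_le_sum.
  have tl0 : 0 < tau l.+1 by exact: lt_le_trans (tau_ge _).
  have aZ : adapted (history l) (fun w => r * mart l w).
    by move=> w w' ww'; rewrite (adapted_mart ww').
  have := lindeberg_step c k0 dG l1 aZ tl0 b0.
  have -> : tau l.+1 + b ^+ 2 = tau l.
    by rewrite /tau (@big_ltn _ _ _ l n)// /b exprMn; ring.
  have -> : (fun w => G ((c - (r * mart l w + b * noise l.+1 w)) / Num.sqrt (tau l.+1)))
      = fun w => G ((c - r * mart l.+1 w) / Num.sqrt (tau l.+1)).
    by apply/funext => w; rewrite /mart [in RHS]big_nat_recr//= (mulrDr r) (mulrA r).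
  move=> /le_trans; apply; rewrite /E.
  have e0 : 0 <= Ex P (fun w => drift l w ^+ 2) by apply: Ex_ge0 => w; exact: sqr_ge0.
  have it : (tau l.+1)^-1 <= t0^-1 by rewrite lef_pV2.
  have isq : (Num.sqrt (tau l.+1))^-1 <= (Num.sqrt t0)^-1.
    by rewrite lef_pV2 ?posrE ?sqrtr_gt0// ler_wsqrtr.
  have isq0 : 0 <= (Num.sqrt (tau l.+1))^-1 by rewrite invr_ge0 sqrtr_ge0.
  have it0 : 0 <= (tau l.+1)^-1 by rewrite invr_ge0 ltW.
  rewrite (mulrDl (C1 * m)); apply: lerD; first apply: lerD.
  - apply: (@le_trans _ _ (C1 * b ^+ 3)).
      rewrite ler_wpM2r ?exprn_ge0// /C1 ler_wpM2l ?mulr_ge0// -!exprVn.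
      by rewrite lerXn2r ?nnegrE ?invr_ge0 ?sqrtr_ge0.
    by rewrite -mulrA ler_wpM2l// exprS -exprMn -/b ler_wpM2r ?sqr_ge0.
  - apply: (@le_trans _ _ (C2 * b ^+ 4)).
      rewrite ler_wpM2r ?exprn_ge0// /C2 ler_wpM2l ?mulr_ge0// -!exprVn.
      by rewrite lerXn2r ?nnegrE ?invr_ge0 ?(ltW tl0) ?(ltW t00).
    rewrite -mulrA ler_wpM2l// (_ : b ^+ 4 = b ^+ 2 * b ^+ 2); last by ring.
    by rewrite -(exprMn _ r) -/b ler_wpM2r ?sqr_ge0// lerXn2r ?nnegrE.
  - rewrite /b exprMn (_ : k / t0 * _ = r ^+ 2 * u l.+1 ^+ 2 * (k / t0) *
      Ex P (fun w => drift l w ^+ 2)); last by ring.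
    have ru : 0 <= r ^+ 2 * u l.+1 ^+ 2 by rewrite -(exprMn _ r) sqr_ge0.
    by rewrite ler_wpM2r//; apply: ler_wpM2l => //; exact: ler_wpM2l.
have tot l : (1 <= l <= n)%N -> `|psi l - psi 1%N| <= \sum_(1 <= j < l) E j.
  elim: l => // -[|l] IH; first by rewrite subrr normr0 big_geq.
  move=> /andP[_ ln]; rewrite big_nat_recr//= addrC.
  rewrite (_ : psi l.+2 - psi 1%N = (psi l.+2 - psi l.+1) + (psi l.+1 - psi 1%N));
    last by rewrite addrA subrK.
  apply: (le_trans (ler_normD _ _)); apply: lerD; first exact: psiS.
  by apply: IH => /=; exact: ltnW.
have := tot n; rewrite n1 leqnn => /(_ isT).
have -> : psi 1%N = G (c / Num.sqrt (t0 + V n)).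
  rewrite /psi -[RHS](Ex_cst P); congr Ex; apply/funext => w.
  by rewrite /mart big_geq// mulr0 subr0.
have -> : psi n = Ex P (fun w => G ((c - r * mart n w) / Num.sqrt t0)).
  by rewrite /psi /tau [X in r ^+ 2 * X]big_geq// mulr0 addr0.
move=> /le_trans; apply.
rewrite /E big_split/= -!mulr_sumr lexx//.
Qed.

Lemma G_lipschitz x y : `|G x - G y| <= k * `|x - y|.
Proof.
wlog xy : x y / y <= x => [H|].
  by case: (leP y x) => [|/ltW] /H //; rewrite distrC => /le_trans; apply; rewrite distrC.
rewrite (ger0_norm (_ : 0 <= x - y)) ?subr_ge0//.
apply: (@mvt_le _ G (gauss_density k) y x k xy) => z _.
rewrite ger0_norm; [exact: gauss_density_le|exact: gauss_density_ge0].
Qed.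

Lemma adapted_err_bound n : adapted (history n) (err_bound n).
Proof.
move=> w w' ww'; congr (1 + _); apply: eq_big_nat => j /andP[j1 jn].
have aD : adapted (history j) (card_D j) by exact: adapted_card_D.
by rewrite (adapted_historyW (ltnW jn) aD ww').
Qed.

Lemma err_bound_ge0 n w : 0 <= err_bound n w.
Proof.
rewrite addr_ge0//; apply: sumr_ge0 => j _.
by rewrite mulr_ge0// divr_ge0// mulr_ge0 ?weight_ge0// addr_ge0.
Qed.

Local Notation W n w := (rho n * (u n * walk_step n w)).

Lemma bounded_rv_smooth (b c : R) n (Z : T -> R) : adapted (history n) Z ->
  bounded_rv (fun w => G ((c - Z w) / b)).
Proof. by move=> aZ; apply: (@history_bounded_rv n) => w w' ww'; rewrite (aZ _ _ ww'). Qed.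

Lemma adapted_normalized_walk n : adapted (history n) (fun w => W n w).
Proof. by move=> w w' ww'; rewrite (adapted_walk_step HX ww'). Qed.

Lemma smooth_cvg (t0 c : R) : 0 < t0 ->
  Ex P (fun w => G ((c - W n w) / Num.sqrt t0)) @[n --> \oo] --> G (c / Num.sqrt (t0 + 1)).
Proof.
move=> t00; have s0 : 0 < Num.sqrt t0 by rewrite sqrtr_gt0.
pose A n := Ex P (fun w => G ((c - W n w) / Num.sqrt t0)).
pose B n := Ex P (fun w => G ((c - rho n * mart n w) / Num.sqrt t0)).
pose g n := G (c / Num.sqrt (t0 + V n)).
have gcvg : g n @[n --> \oo] --> G (c / Num.sqrt (t0 + 1)).
  have Gc : {for c / Num.sqrt (t0 + 1), continuous G}.
    by apply: differentiable_continuous; apply/derivable1_diffP; case: (dG (c / Num.sqrt (t0 + 1))).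
  apply: (cvg_continuous_comp Gc); apply: cvgM; first exact: cvg_cst.
  apply: cvgV; first by rewrite gt_eqF// sqrtr_gt0; lra.
  apply: (cvg_continuous_comp (h := Num.sqrt)); first exact: sqrt_continuous.
  by apply: cvgD => //; exact: cvg_cst.
have BgN : B n - g n @[n --> \oo] --> 0.
  pose bd n := (24 * k / Num.sqrt t0 ^+ 3 * (rho n + rho n * u n)
    + 9 * k / t0 ^+ 2 * ((rho n + rho n * u n) * (rho n + rho n * u n))) * V n
    + k / t0 * (rho n ^+ 2 * \sum_(1 <= j < n) u j.+1 ^+ 2 * Ex P (fun w => drift j w ^+ 2)).
  apply: (@norm_squeeze_cvg0 _ _ bd).
    near=> n; have n1 : (1 <= n)%N by near: n; exact: nbhs_infty_ge.
    have := lindeberg_sum c t00 n1.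
    by rewrite /bd -expr2 (mulrDr (rho n) 1) mulr1.
  have m0 : rho n + rho n * u n @[n --> \oo] --> (0 + 0 : R) by exact: cvgD.
  rewrite addr0 in m0.
  have -> : 0 = (24 * k / Num.sqrt t0 ^+ 3 * 0 + 9 * k / t0 ^+ 2 * (0 * 0)) * 1
    + k / t0 * 0 :> R by ring.
  apply: cvgD; apply: cvgM; rewrite //; last first.
  - apply: (@toeplitz_null _ (fun n => rho n ^+ 2) (fun j => u j.+1 ^+ 2)
      (fun j => Ex P (fun w => drift j w ^+ 2)) 2).
    + by move=> n; exact: sqr_ge0.
    + under eq_fun do rewrite expr2.
      by rewrite -(mulr0 (0 : R)); exact: cvgM.
    + by move=> j _; exact: sqr_ge0.
    (* Eventually [V n <= 2], the constant given to [toeplitz_null]. *)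
    + near=> n; have h : `|1 - V n| <= 1.
        by near: n; move/cvgrPdist_le : variance_cvg1; apply.
      by move: h; rewrite ler_norml => /andP[h _]; lra.
    + exact: Ex_drift_sqr_cvg0.
  - exact: cvg_cst.
  - by apply: cvgD; apply: cvgM; rewrite //; [exact: cvg_cst|exact: cvg_cst|exact: cvgM].
have ABN : A n - B n @[n --> \oo] --> 0.
  apply: (@norm_squeeze_cvg0 _ _ (fun n => (1 + k / Num.sqrt t0) *
    Ex P (fun w => Num.min 1 (rho n * err_bound n w)))); last first.
    by rewrite -(mulr0 (1 + k / Num.sqrt t0)); apply: cvgM => //; exact: cvg_cst.
  near=> n; have n1 : (1 <= n)%N by near: n; exact: nbhs_infty_ge.
  have bA : bounded_rv (fun w => G ((c - W n w) / Num.sqrt t0)).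
    exact: bounded_rv_smooth (@adapted_normalized_walk n).
  have bB : bounded_rv (fun w => G ((c - rho n * mart n w) / Num.sqrt t0)).
    by apply: (@bounded_rv_smooth _ _ n) => w w' ww'; rewrite (adapted_mart ww').
  have be : bounded_rv (fun w => Num.min 1 (rho n * err_bound n w)).
    by apply: (@history_bounded_rv n) => w w' ww'; rewrite (adapted_err_bound ww').
  have bBA := bounded_rvB bA bB.
  rewrite /A /B -ExB//; apply: (le_trans (Ex_norm_le P bBA)); rewrite -ExZ//.
  apply: Ex_le.
  - split; first by apply: measurableT_comp => //; case: bBA.
    by case: bBA => _ [C hC]; exists C => w; rewrite normr_id.
  - by apply: bounded_rvM; [exact: bounded_rv_cst|exact: be].
  move=> w; set e := rho n * err_bound n w.
  have e0 : 0 <= e by rewrite mulr_ge0 ?rho0 ?err_bound_ge0.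
  have ks0 : 0 <= k / Num.sqrt t0 by rewrite divr_ge0// ltW.
  (* A large remainder is absorbed by [0 <= G <= 1], a small one by the Lipschitz bound. *)
  have [e1|e1] := leP 1 e.
    rewrite mulr1; apply: (@le_trans _ _ 1); last by lra.
    have /andP[g1 g2] := G01 ((c - W n w) / Num.sqrt t0).
    have /andP[g3 g4] := G01 ((c - rho n * mart n w) / Num.sqrt t0).
    by rewrite ler_norml; apply/andP; split; lra.
  apply: (le_trans (G_lipschitz _ _)); rewrite -mulrBl.
  have -> : c - W n w - (c - rho n * mart n w) =
    - (rho n * (u n * walk_step n w - mart n w)) by ring.
  rewrite normrM normrN normrM (ger0_norm (rho0 n)) normfV (ger0_norm (ltW s0)).
  apply: (@le_trans _ _ (k * (e / Num.sqrt t0))).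
    by rewrite ler_wpM2l// ler_wpM2r ?invr_ge0 ?(ltW s0)// ler_wpM2l ?rho0// walk_decomposition.
  rewrite (_ : k * (e / _) = k / Num.sqrt t0 * e); last by ring.
  by rewrite mulrDl mul1r lerDr.
have -> : (fun n => Ex P (fun w => G ((c - W n w) / Num.sqrt t0))) =
    (fun n => (A n - B n) + (B n - g n) + g n).
  by apply/funext => n; rewrite /A; ring.
rewrite -[X in _ --> X]add0r; apply: cvgD => //.
by rewrite -[X in _ --> X]addr0; exact: cvgD.
Unshelve. all: by end_near. Qed.

(** With [t] the standard deviation of the smoothing, the indicator is squeezed, up to [e / 3],
    between smoothed functions with thresholds [x - K t] and [x + K t]. Their limits
    [G ((x -+ K t) / sqrt (t^2 + 1))] tend to [G x] as [t] decreases to 0. *)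
Lemma normalized_walk_clt (x : R) :
  Ex P (\1_[set w | W n w <= x]) @[n --> \oo] --> G x.
Proof.
apply/cvgrPdist_le => e e0; pose e3 := e / 3.
have e30 : 0 < e3 by rewrite divr_gt0.
have [K [K0 GK GNK]] := G_tails e30.
have Gc (z : R) : {for z, continuous G}.
  by apply: differentiable_continuous; apply/derivable1_diffP; case: (dG z).
have Gs (s : R) : G ((x + s * t) / Num.sqrt (t ^+ 2 + 1)) @[t --> 0^'+] --> G x.
  have -> : G x = G ((x + s * 0) / Num.sqrt (0 ^+ 2 + 1)).
    by rewrite mulr0 addr0 expr0n/= add0r sqrtr1 divr1.
  apply: cvg_at_right_filter.
  apply: (@cvg_comp _ _ _ (fun t => (x + s * t) / Num.sqrt (t ^+ 2 + 1)) G _ _ _ _ (Gc _)).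
  apply: cvgM.
    by apply: cvgD; [exact: cvg_cst|apply: cvgM; [exact: cvg_cst|exact: cvg_id]].
  apply: cvgV; first by rewrite expr0n/= add0r sqrtr1 oner_neq0.
  apply: (@cvg_comp _ _ _ (fun t => t ^+ 2 + 1) Num.sqrt _ _ _ _ (@sqrt_continuous _ _)).
  apply: cvgD; last exact: cvg_cst.
  exact: sqr_continuous.
have /cvgrPdist_le/(_ _ e30) hp := Gs K.
have /cvgrPdist_le/(_ _ e30) hm := Gs (- K).
have [t [[t0 h1] h2]] : exists t : R, (0 < t /\
    `|G x - G ((x + K * t) / Num.sqrt (t ^+ 2 + 1))| <= e3) /\
    `|G x - G ((x + - K * t) / Num.sqrt (t ^+ 2 + 1))| <= e3.
  apply: (@filter_ex _ (at_right (0 : R))); apply: filterI hm.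
  by apply: filterI hp; exact: nbhs_right_gt.
have tt0 : 0 < t ^+ 2 by rewrite exprn_gt0.
have st : Num.sqrt (t ^+ 2) = t by rewrite sqrtr_sqr gtr0_norm.
have /cvgrPdist_le/(_ _ e30) cp := smooth_cvg (c := x + K * t) tt0.
have /cvgrPdist_le/(_ _ e30) cm := smooth_cvg (c := x + - K * t) tt0.
move: cp cm; apply: filterS2 => n cp cm.
rewrite st in cp cm.
have aW := @adapted_normalized_walk n.
have mW : measurable [set w | W n w <= x].
  rewrite (_ : [set w | _] = history n @^-1` [set h | exists w, history n w = h /\ W n w <= x]).
    exact: (fin_code_measurable _ (fin_code_history HX n)).
  apply/seteqP; split=> w /=; first by exists w.
  by case=> w' [hw]; rewrite -(aW _ _ hw).
have b1 := bounded_rv_indic R mW.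
have bG c : bounded_rv (fun w => G ((c - W n w) / t)) := bounded_rv_smooth _ _ aW.
(* Where [W n w <= x], the argument of [G] is at least [K], so that [G] is at least [1 - e3]. *)
have up : Ex P (\1_[set w | W n w <= x]) <=
    Ex P (fun w => G ((x + K * t - W n w) / t)) + e3.
  have -> : Ex P (fun w => G ((x + K * t - W n w) / t)) + e3 =
      Ex P (fun w => G ((x + K * t - W n w) / t) + e3).
    by rewrite ExD ?Ex_cst//; exact: bounded_rv_cst.
  apply: Ex_le => //; first by apply: bounded_rvD => //; exact: bounded_rv_cst.
  move=> w; have /andP[g0 _] := G01 ((x + K * t - W n w) / t).
  rewrite indicE; have [Wx|Wx] := boolP (w \in _); last by rewrite addr_ge0// ltW.
  rewrite inE/= in Wx; have : G K <= G ((x + K * t - W n w) / t).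
    by apply: G_homo; rewrite ler_pdivlMr//; lra.
  move: GK => /=; lra.
have lo : Ex P (fun w => G ((x + - K * t - W n w) / t)) - e3 <=
    Ex P (\1_[set w | W n w <= x]).
  have -> : Ex P (fun w => G ((x + - K * t - W n w) / t)) - e3 =
      Ex P (fun w => G ((x + - K * t - W n w) / t) - e3).
    by rewrite ExB ?Ex_cst//; exact: bounded_rv_cst.
  apply: Ex_le => //; first by apply: bounded_rvB => //; exact: bounded_rv_cst.
  move=> w; have /andP[_ g1] := G01 ((x + - K * t - W n w) / t).
  rewrite indicE; have [Wx|Wx] := boolP (w \in _); first by rewrite /=; lra.
  have {}Wx : x < W n w by rewrite ltNge; apply/negP => h; move/negP: Wx; apply; rewrite inE.
  have : G ((x + - K * t - W n w) / t) <= G (- K).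
    by apply: G_homo; rewrite ler_pdivrMr//; lra.
  by rewrite /=; lra.
have e33 : e = 3 * e3 by rewrite /e3; field.
move: h1 h2 cp cm; rewrite !ler_norml e33 => /andP[? ?] /andP[? ?] /andP[? ?] /andP[? ?].
by apply/andP; split; lra.
Qed.

End Clt.

End Martingale.

(** * Almost sure convergence in the superdiffusive regime *)

Section Superdiffusive.
Context d (T : measurableType d) (R : realType) (P : probability T R).
Context (p lambda : R) (D : nat -> T -> {fset nat}).
Context (X Y eps : nat -> {RV P >-> R}) (I : nat -> {RV P >-> nat}).
Hypothesis HX : TMERW P p lambda D X Y eps I.
Hypotheses (p01 : 0 <= p <= 1) (lambda01 : 0 <= lambda <= 1).
Local Notation a := (2 * p - 1).
Hypothesis a_gt : 1 / 2 < a.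
Local Notation u := (weight a).
Local Notation history := (history D X Y eps I).
Local Notation walk_step := (walk_step D X Y eps I).
Local Notation card_D := (@card_D _ _ R D).
Local Notation noise := (noise p lambda D X Y eps I).
Local Notation mart := (mart p lambda D X Y eps I).
Local Notation err_bound := (err_bound p D).

Lemma superdiffusive_gt0 : 0 < 2 * a - 1.
Proof. by rewrite subr_gt0 mulrC -ltr_pdivrMr. Qed.

(* The increment [mart (m + i) - mart m], frozen at the first time it reaches
   [e] in absolute value. *)
Fixpoint stopped (m : nat) (e : R) (i : nat) (w : T) : R :=
  if i is i'.+1 then
    stopped m e i' w +
    (`|stopped m e i' w| < e)%R%:R * (u (m + i').+1 * noise (m + i').+1 w)
  else 0.

Lemma stopped_ge m e i w : e <= `|stopped m e i w| -> e <= `|stopped m e i.+1 w|.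
Proof. by move=> ei /=; rewrite ltNge ei mul0r addr0. Qed.

Lemma stopped_mart m e i w : (1 <= m)%N -> `|stopped m e i w| < e ->
  stopped m e i w = mart (m + i) w - mart m w.
Proof.
move=> m1; elim: i => [|i IH]; first by rewrite addn0 subrr.
move=> iS; have [ie|ie] := ltP `|stopped m e i w| e; last first.
  by move: iS; rewrite ltNge stopped_ge.
by rewrite /= ie mul1r IH// addnS martS ?(leq_trans m1) ?leq_addr// addrAC.
Qed.

Lemma adapted_stopped m e i : (1 <= m)%N -> adapted (history (m + i)) (stopped m e i).
Proof.
move=> m1; elim: i => [//|i IH] w w' ww' /=.
have im : (m + i <= m + i.+1)%N by rewrite leq_add2l.
rewrite (adapted_historyW im IH ww'); congr (_ + _ * (_ * _)).
rewrite addnS in ww'; apply: (adapted_noise HX _ ww').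
by rewrite (leq_trans m1)// leq_addr.
Qed.

(** Whether the process is frozen is known from the past, so cross terms have mean 0; each new
    square is at most [4 u^2] as [|noise| <= 2]. *)
Lemma Ex_stopped_sqr m e i : (1 <= m)%N ->
  Ex P (fun w => stopped m e i w ^+ 2) <= \sum_(m <= j < m + i) 4 * u j.+1 ^+ 2.
Proof.
move=> m1; elim: i => [|i IH].
  rewrite addn0 big_geq// (_ : (fun w => _) = fun=> 0) ?Ex_cst//.
  by apply/funext => w; rewrite expr0n.
rewrite addnS big_nat_recr ?leq_addr//=; set n := (m + i)%N in IH *.
have n1 : (1 <= n)%N by rewrite (leq_trans m1)// leq_addr.
have ast := @adapted_stopped m e i m1.
pose g w := 2 * u n.+1 * ((`|stopped m e i w| < e)%R%:R * stopped m e i w).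
have ag : adapted (history n) g by move=> w w' ww'; rewrite /g (ast _ _ ww').
have bs2 : bounded_rv (fun w => stopped m e i w ^+ 2).
  by apply: (history_bounded_rv HX (n := n)) => w w' ww'; rewrite (ast _ _ ww').
have bg := history_bounded_rv HX ag.
have bn := history_bounded_rv HX (adapted_noise HX n1).
have bng := bounded_rvM bn bg.
have bc := bounded_rv_cst T (4 * u n.+1 ^+ 2).
apply: (@le_trans _ _ (Ex P (fun w => stopped m e i w ^+ 2 + noise n.+1 w * g w
    + 4 * u n.+1 ^+ 2))); last first.
  rewrite ExD//; last exact: bounded_rvD.
  by rewrite ExD// (Ex_noise HX n1 ag) addr0 Ex_cst lerD2r.
apply: Ex_le; [|by apply: bounded_rvD => //; exact: bounded_rvD|].
  apply: (history_bounded_rv HX (n := n.+1)) => w w' ww'.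
  rewrite -(addnS m i) in ww'.
  by have /= -> := @adapted_stopped m e i.+1 m1 w w' ww'.
move=> w; rewrite /g /=; move: (stopped m e i w) => s.
have := noise_le HX p01 lambda01 w n1.
have u0 : 0 <= u n.+1 := weight_ge0 _ _.
rewrite -/n; move: (noise n.+1 w) => x x2.
have x4 : x ^+ 2 <= 4.
  have -> : 4 = 2 ^+ 2 :> R by ring.
  by rewrite -(real_normK (num_real x)) lerXn2r// nnegrE.
have := ler_wpM2l (sqr_ge0 (u n.+1)) x4.
case: (_ < e); rewrite /= ?mul1r ?mul0r.
  move: (u n.+1) => v; lra.
by rewrite !(mulr0, addr0) => _; rewrite lerDl mulr_ge0// sqr_ge0.
Qed.

Lemma sum_weight_sqr m n : (1 <= m)%N ->
  \sum_(m <= j < n) 4 * u j.+1 ^+ 2 <= 4 / (2 * a - 1) * m%:R `^ (- (2 * a - 1)).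
Proof.
move=> m1; have e0 := superdiffusive_gt0.
rewrite -mulr_sumr -mulrA ler_pM2l// [_^-1 * _]mulrC.
apply: le_trans (sum_powR_tail n e0 m1); apply: ler_sum => j _.
rewrite /weight -powR_mulrn ?powR_ge0// -powRrM.
by rewrite (_ : - a * 2 = - 1 - (2 * a - 1))//; ring.
Qed.

Lemma measurable_stopped m e i : (1 <= m)%N -> measurable [set w | e <= `|stopped m e i w|].
Proof.
move=> m1; have as_ := @adapted_stopped m e i m1.
rewrite (_ : [set w | _] = history (m + i) @^-1`
    [set h | exists w, history (m + i) w = h /\ e <= `|stopped m e i w|]).
  exact: (fin_code_measurable _ (fin_code_history HX (m + i))).
apply/seteqP; split=> w /=; first by exists w.
by case=> w' [hw]; rewrite (as_ _ _ hw).
Qed.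

(** Freezing makes the events increase with [i]: the probability of their union is a limit, and each
    of them is bounded by Chebyshev's inequality. *)
Lemma maximal_ineq m e : (1 <= m)%N -> 0 < e ->
  (P (\bigcup_i [set w | e <= `|stopped m e i w|]%R) <=
   (4 / (2 * a - 1) * m%:R `^ (- (2 * a - 1)) / e ^+ 2)%:E)%E.
Proof.
move=> m1 e0; set B := fun i => [set w | e <= `|stopped m e i w|].
have mB i : measurable (B i) by exact: measurable_stopped.
have Bi i : (P (B i) <= (4 / (2 * a - 1) * m%:R `^ (- (2 * a - 1)) / e ^+ 2)%:E)%E.
  rewrite -[P (B i)]fineK ?fin_num_measure// lee_fin -(Ex_indic P (mB i)).
  rewrite ler_pdivlMr ?exprn_gt0// mulrC -ExZ; last exact: bounded_rv_indic.
  apply: le_trans (sum_weight_sqr (m + i) m1).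
  apply: le_trans (Ex_stopped_sqr e i m1); apply: Ex_le.
  - by apply: bounded_rvM; [exact: bounded_rv_cst|exact: bounded_rv_indic].
  - apply: (history_bounded_rv HX (n := m + i)) => w w' ww'.
    by rewrite (adapted_stopped e m1 ww').
  move=> w; rewrite indicE; have [wB|_] := boolP (w \in _); last by rewrite mulr0 sqr_ge0.
  rewrite inE in wB; rewrite mulr1 -(real_normK (num_real (stopped m e i w))).
  by rewrite lerXn2r// nnegrE ltW.
have : (P \o B) i @[i --> \oo] --> P (\bigcup_i B i).
  apply: nondecreasing_cvg_mu => //; first exact: bigcup_measurable.
  by apply/nondecreasing_seqP => i; apply/subsetPset => w; exact: stopped_ge.
move=> h; rewrite -(cvg_lim _ h)//; apply: lime_le; first by apply/cvg_ex; eexists; exact: h.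
by near=> i; exact: Bi.
Unshelve. all: by end_near. Qed.

(** Almost surely, for every [e = 1/(q+1)] there is a time after which the path stays within [e] of
    its value then: the maximal bound tends to 0 with [m]. Hence the path is Cauchy. *)
Lemma mart_cvg_ae : \forall w \ae P, cvgn (mart ^~ w).
Proof.
pose B e m := \bigcup_i [set w | e <= `|stopped m.+1 e i w|].
have mB e m : measurable (B e m).
  by apply: bigcup_measurable => i _; exact: measurable_stopped.
have null e : 0 < e -> P (\bigcap_m B e m) = 0%E.
  move=> e0; have mBB : measurable (\bigcap_m B e m) by apply: bigcap_measurable.
  apply/eqP; rewrite eq_le measure_ge0 andbT.
  have a0 := superdiffusive_gt0.
  have cv : 4 / (2 * a - 1) * (m.+1%:R `^ (2 * a - 1))^-1 / e ^+ 2 @[m --> \oo] --> (0 : R).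
    rewrite -(mul0r (e ^+ 2)^-1) -(mulr0 (4 / (2 * a - 1))).
    apply: cvgM; last exact: cvg_cst.
    apply: cvgM; first exact: cvg_cst.
    rewrite (cvg_shiftS (fun m => (m%:R `^ (2 * a - 1))^-1)).
    apply/gtr0_cvgV0; last exact: cvg_powR_pinfty.
    by near=> n; rewrite powR_gt0// ltr0n; near: n; exact: nbhs_infty_gt.
  rewrite -[P _]fineK ?fin_num_measure// lee_fin.
  apply: (cvgr_to_ge cv); near=> m.
  rewrite -lee_fin fineK ?fin_num_measure//.
  apply: le_trans (_ : _ <= P (B e m))%E _.
    by apply: le_measure; rewrite ?inE//; exact: bigcap_inf.
  by have := maximal_ineq (ltn0Sn m) e0; rewrite powRN.
have all_e : \forall w \ae P, forall q, ~ (\bigcap_m B q.+1%:R^-1 m) w.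
  apply: ae_foralln => q; exists (\bigcap_m B q.+1%:R^-1 m); split.
  - exact: bigcap_measurable.
  - by apply: null; rewrite invr_gt0.
  - by move=> w /= /contrapT.
apply: filterS all_e => w hw; apply: cauchy_cvg; apply: cauchy_exP => e e0.
near \oo => q.
have qe : q.+1%:R^-1 < e :> R by near: q; exact: near_infty_natSinv_lt (PosNum e0).
have [m mB'] : exists m, ~ B q.+1%:R^-1 m w.
  by apply/existsNP => h; apply: (hw q) => m _; exact: h.
exists (mart m.+1 w); exists m.+1 => // n /= mn.
have st : `|stopped m.+1 q.+1%:R^-1 (n - m.+1) w| < q.+1%:R^-1.
  by rewrite ltNge; apply/negP => h; apply: mB'; exists (n - m.+1)%N.
have := stopped_mart (ltn0Sn m) st; rewrite subnKC// => E.
rewrite /ball/= distrC -E; exact: lt_trans qe.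
Unshelve. all: by end_near. Qed.

Local Notation err n w := (u n * walk_step n w - mart n w).

(** The terms are of order [j^(gamma - a - 1)], which is summable. The critical regime relies on
    this bound too. *)
Lemma err_bound_bounded (gamma : R) w : 0 <= gamma < a ->
  (fun n => card_D n w) =O_\oo (fun n => n%:R `^ gamma : R) ->
  exists C, forall n, err_bound n w <= C.
Proof.
move=> /andP[g0 ga] /eqO_exP[c c0 [N _ hN]].
(* [c] serves from rank [N] on; below it, [|D_j| <= j <= N]. *)
pose K := c + N%:R; have K0 : 0 <= K by rewrite addr_ge0// ltW.
have hK j : (1 <= j)%N -> card_D j w <= K * j%:R `^ gamma.
  move=> j1; have jg : 1 <= j%:R `^ gamma :> R.
    by have := @ler_powR R j%:R _ _ _ g0; rewrite powRr0; apply; rewrite ler1n.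
  have [Nj|jN] := leqP N j.
    have := hN _ Nj; rewrite ger0_norm// ger0_norm ?powR_ge0// => /le_trans; apply.
    by rewrite ler_wpM2r ?powR_ge0// lerDl.
  apply: (@le_trans _ _ (N%:R * 1)).
    by rewrite mulr1; apply: (le_trans (card_D_le HX w j1)); rewrite ler_nat ltnW.
  by apply: ler_pM => //; rewrite lerDr ltW.
have e0 : 0 < a - gamma by rewrite subr_gt0.
exists (1 + 4 * (1 + K) * (1%:R `^ (- (a - gamma)) / (a - gamma))) => n.
rewrite lerD2l; apply: le_trans (ler_wpM2l _ (sum_powR_tail n e0 (leqnn 1))); last first.
  by rewrite mulr_ge0// addr_ge0.
rewrite mulr_sumr; apply: ler_sum_nat => j /andP[j1 _]; rewrite -!mulrA ler_pM2l//.
have jS : 1 + card_D j w <= (1 + K) * j.+1%:R `^ gamma.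
  have j1g : 1 <= j.+1%:R `^ gamma :> R.
    by have := @ler_powR R j.+1%:R _ _ _ g0; rewrite powRr0; apply; rewrite ler1n.
  rewrite mulrDl mul1r; apply: lerD => //; apply: (le_trans (hK _ j1)).
  by rewrite ler_wpM2l// ge0_ler_powR ?nnegrE// ler_nat.
have j0 : j.+1%:R != 0 :> R by rewrite pnatr_eq0.
rewrite (_ : - 1 - (a - gamma) = - a + gamma - 1); last by ring.
rewrite powRB ?j0 ?implybT// powRD ?j0 ?implybT// powRr1// mulrA mulrA ler_wpM2r ?invr_ge0//.
by rewrite [leRHS]mulrCA ler_wpM2l ?powR_ge0.
Qed.

(** The increments are dominated by those of [err_bound], which form a summable series; convergence
    is absolute. *)
Lemma err_cvg w C : (forall n, err_bound n w <= C) -> cvgn (fun n => err n w).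
Proof.
move=> eC.
pose x n := err n.+2 w - err n.+1 w.
pose v n := 4 * (u n.+2 * (1 + card_D n.+1 w) / n.+2%:R).
have v0 n : 0 <= v n.
  by rewrite mulr_ge0// divr_ge0// mulr_ge0 ?weight_ge0// addr_ge0.
have xv n : `|x n| <= v n by exact: (err_step HX).
have vcvg : cvgn (series v).
  apply: nondecreasing_is_cvgn.
    by apply/nondecreasing_seqP => n; rewrite seriesEnat/= big_nat_recr//= lerDl.
  exists C => _ [n _ <-]; apply: le_trans (eC n.+1).
  by rewrite err_boundS seriesEnat/= lerDr.
have : cvgn (series x).
  by apply: normed_cvg; apply: series_le_cvg vcvg => // n; exact: normr_ge0.
have -> : series x = fun n => err n.+1 w - err 1 w.
  by apply/funext => n; rewrite seriesEnat/= (telescope_sumr (fun n => err n.+1 w)).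
move=> /cvg_ex[l hl]; apply/cvg_ex; exists (l + err 1 w).
rewrite -(cvg_shiftS (fun n => err n w)).
have -> : (fun n => err n.+1 w) = (fun n => (err n.+1 w - err 1 w) + err 1 w).
  by apply/funext => n; rewrite subrK.
by apply: cvgD; [exact: hl|exact: cvg_cst].
Qed.

Lemma walk_cvg_ae : (\forall w \ae P, exists C, forall n, err_bound n w <= C) ->
  \forall w \ae P, cvgn (fun n => walk X n w / n%:R `^ a).
Proof.
move=> hC; apply: filterS3 hC mart_cvg_ae (walk_step_ae HX) => w [C wC] /cvg_ex[l hl] wE.
have /cvg_ex[l' hl'] := err_cvg wC.
apply/cvg_ex; exists (l' + l).
have -> : (fun n => walk X n w / n%:R `^ a) = (fun n => err n w + mart n w).
  by apply/funext => n; rewrite wE subrK mulrC /weight powRN.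
exact: cvgD.
Qed.

End Superdiffusive.

Lemma probability_ae_eq d (T : measurableType d) (R : realType)
    (P : probability T R) (A B : set T) :
  measurable A -> measurable B -> (\forall w \ae P, A w <-> B w) -> P A = P B.
Proof.
move=> mA mB AB; rewrite -(setIT A) -(setIT B) -!integral_indic//.
apply: ge0_ae_eq_integral => //.
- by apply/measurable_EFinP; exact: measurable_indic.
- by apply/measurable_EFinP; exact: measurable_indic.
apply: filterS AB => w AB _; congr (_%:E); rewrite !indicE.
by congr (_%:R); congr nat_of_bool; apply/idP/idP; rewrite !inE => /AB.
Qed.

(** Hölder's inequality against the constant 1, whose L^2 norm is 1 under a probability. *)
Lemma Ex_le_Lnorm2 d (T : measurableType d) (R : realType)
    (P : probability T R) (f : T -> R) : bounded_rv f -> (forall w, 0 <= f w) ->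
  ((Ex P f)%:E <= 'N[P]_2%:E[EFin \o f])%E.
Proof.
move=> bf f0; have mf : measurable_fun setT f by case: bf.
have mc : measurable_fun [set: T] (cst (1 : R)) by exact: measurable_cst.
have two : (0 < 2 :> R) by [].
have pq : (2^-1 + 2^-1 = 1 :> R) by rewrite -div1r -mulrDl divff.
have := hoelder P mf mc two two pq.
have -> : 'N[P]_2%:E[EFin \o (cst 1%R : T -> R)]%E = 1%E.
  rewrite Lnorm_cst1; transitivity ((1 : \bar R) `^ 2^-1)%E; last exact: poweR1r.
  by congr (_ `^ _)%E; exact: probability_setT.
rewrite mule1 Lnorm1; apply: le_trans.
rewrite /Ex /Rintegral fineK; last first.
  by apply: integrable_fin_num => //; exact: bounded_rv_integrable.
rewrite le_eqVlt; apply/orP; left; apply/eqP; apply: eq_integral => w _ /=.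
by rewrite mulr1 ger0_norm.
Qed.

Lemma powRN_cvg0 (R : realType) (s : R) : 0 < s ->
  n%:R `^ (- s) @[n --> \oo] --> (0 : R).
Proof.
move=> s0; under eq_cvg do rewrite powRN.
apply/gtr0_cvgV0; last exact: cvg_powR_pinfty.
by near=> n; rewrite powR_gt0// ltr0n; near: n; exact: nbhs_infty_gt.
Unshelve. all: by end_near. Qed.

Lemma normal_cdf_homo (R : realType) (s : R) : 0 < s ->
  {homo normal_cdf s : x y / x <= y}.
Proof.
move=> s0 x y xy; have sK z : z = s * z / s by rewrite mulrAC divff ?gt_eqF// mul1r.
rewrite (sK x) (sK y) -lee_fin -!normal_cdfE//.
by apply: le_measure; rewrite ?inE// => z /=; rewrite !in_itv/= => /le_trans; apply; rewrite ler_pM2l.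
Qed.

Lemma powR_Nhalf (R : realType) (n : nat) : n%:R `^ (- (1 / 2)) = (Num.sqrt n%:R)^-1 :> R.
Proof. by rewrite powRN div1r powR12_sqrt. Qed.

(** * The three regimes *)

Section Assembly.
Context d (T : measurableType d) (R : realType) (P : probability T R).
Context (p lambda : R) (D : nat -> T -> {fset nat}).
Context (X Y eps : nat -> {RV P >-> R}) (I : nat -> {RV P >-> nat}).
Hypothesis HX : TMERW P p lambda D X Y eps I.
Hypotheses (p01 : 0 <= p <= 1) (lambda01 : 0 <= lambda <= 1).
Local Notation a := (2 * p - 1).
Local Notation u := (weight a).
Local Notation history := (history D X Y eps I).
Local Notation walk_step := (walk_step D X Y eps I).
Local Notation card_D := (@card_D _ _ R D).
Local Notation err_bound := (err_bound p D).
Hypothesis HD : \forall w \ae P, card_D n w / n%:R @[n --> \oo] --> (0 : R).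

Lemma cvg_in_law_normal (s : R) (U : nat -> {RV P >-> R}) (rho : nat -> R) :
  0 < s -> a <= 1 / 2 -> (forall n, 0 <= rho n) -> rho n @[n --> \oo] --> 0 ->
  rho n * u n @[n --> \oo] --> 0 ->
  rho n ^+ 2 * (\sum_(1 <= j < n) u j.+1 ^+ 2) @[n --> \oo] --> (1 : R) ->
  Ex P (fun w => Num.min 1 (rho n * err_bound n w)) @[n --> \oo] --> (0 : R) ->
  (forall n w, (1 <= n)%N -> U n w = s * (rho n * (u n * walk X n w))) ->
  cvg_in_law P U (normal_prob 0 s).
Proof.
(* The limit has a continuous distribution function, and convergence is proved at every [x]. *)
move=> s0 a2 rho0 rc ruc vc ec UE x _.
have k0 : 0 <= s * normal_peak s by rewrite mulr_ge0 ?normal_peak_ge0// ltW.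
have h01 z : 0 <= normal_cdf s z <= 1 by rewrite normal_cdf_ge0 normal_cdf_le1.
have := normalized_walk_clt HX p01 lambda01 HD a2 k0 (is_derive_normal_cdf s0) h01
  (normal_cdf_homo s0) (normal_cdf_tails s0) rho0 rc ruc vc ec (x := x / s).
suff : Ex P \1_[set w | rho n * (u n * walk_step n w) <= x / s] @[n --> \oo] -->
    normal_cdf s (x / s) -> cdf (U n) x @[n --> \oo] --> (normal_cdf s (x / s))%:E.
  by rewrite -(normal_cdfE s0).
move=> hc; apply: cvg_EFin; first by apply: nearW => n; exact: fin_num_measure.
apply: cvg_trans hc; apply: near_eq_cvg; near=> n.
have n1 : (1 <= n)%N by near: n; exact: nbhs_infty_gt.
set W := fun w => rho n * (u n * walk_step n w).
have mW : measurable [set w | W w <= x / s].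
  have [mW _] : bounded_rv W.
    by apply: (history_bounded_rv HX (n := n)); exact: (adapted_normalized_walk HX).
  rewrite (_ : [set w | _] = W @^-1` `]-oo, (x / s)]); last first.
    by apply/seteqP; split => w /=; rewrite in_itv.
  by rewrite -[X in measurable X]setTI; exact: mW.
rewrite Ex_indic//=; congr fine.
apply: probability_ae_eq => //.
  by rewrite -[X in measurable X]setTI; exact: measurable_funP.
apply: filterS (walk_step_ae HX) => w wE.
by rewrite /= in_itv/= UE// wE ler_pdivlMr// mulrC.
Unshelve. all: by end_near. Qed.

Lemma Ex_err_bound n : Ex P (err_bound n) =
  1 + \sum_(1 <= j < n) 4 * (u j.+1 * (1 + Ex P (card_D j)) / j.+1%:R).
Proof.
have b1 (c : R) := @bounded_rv_cst _ T R c.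
have bD i : bounded_rv (fun w => 1 + card_D i.+1 w).
  by apply: bounded_rvD => //; exact: (bounded_rv_card_D HX).
have bF i : bounded_rv (fun w => 4 * (u i.+2 / i.+2%:R) * (1 + card_D i.+1 w)).
  exact: bounded_rvM.
rewrite big_add1 -[X in X + _](Ex_cst P).
rewrite (eq_bigr (fun i => Ex P (fun w => 4 * (u i.+2 / i.+2%:R) * (1 + card_D i.+1 w)))).
  rewrite -Ex_sum// -ExD//; last exact: bounded_rv_sum.
  congr Ex; apply/funext => w; rewrite /err_bound big_add1; congr (_ + _).
  by apply: eq_bigr => i _; ring.
by move=> i _; rewrite ExZ// ExD ?Ex_cst//; [ring|exact: (bounded_rv_card_D HX)].
Qed.

Lemma Ex_min_err_le (r : R) n : 0 <= r ->
  0 <= Ex P (fun w => Num.min 1 (r * err_bound n w)) <= r * Ex P (err_bound n).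
Proof.
move=> r0; have bE : bounded_rv (err_bound n).
  by apply: (history_bounded_rv HX (n := n)); exact: adapted_err_bound.
have bM : bounded_rv (fun w => Num.min 1 (r * err_bound n w)).
  by apply: (history_bounded_rv HX (n := n)) => w w' /adapted_err_bound ->.
have b1 : bounded_rv (fun w => r * err_bound n w).
  by apply: bounded_rvM => //; exact: bounded_rv_cst.
apply/andP; split.
  by apply: Ex_ge0 => w; rewrite le_min ler01 mulr_ge0// err_bound_ge0.
by rewrite -ExZ//; apply: Ex_le => // w; rewrite ge_min lexx orbT.
Qed.

Lemma diffusive_clt (hp : p < 3 / 4) :
  ('N[P]_2%:E[(fun w => (card_D n w / Num.sqrt n%:R)%:E)])%E @[n --> \oo] --> 0%E ->
  cvg_in_law P (fun n => (Num.sqrt n%:R)^-1 \o* walk X n)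
    (normal_prob 0 (Num.sqrt (3 - 4 * p)^-1)).
Proof.
move=> HN; set s := Num.sqrt _; pose b := 1 / 2 - a.
have b0 : 0 < b by rewrite /b; lra.
have q0 : 0 < (3 - 4 * p)^-1 by rewrite invr_gt0; lra.
have s0 : 0 < s by rewrite sqrtr_gt0.
have s2 : s ^+ 2 = (3 - 4 * p)^-1 by rewrite sqr_sqrtr// ltW.
(* Chosen so that [rho n * u n = s^-1 / sqrt n]; as the sum of [u^2] is equivalent to
   [n^(1 - 2 a) / (1 - 2 a)] and [s^2 = 1 / (1 - 2 a)], the variance tends to 1. *)
pose rho (n : nat) : R := s^-1 * n%:R `^ (- b).
have rho0 n : 0 <= rho n by rewrite mulr_ge0 ?powR_ge0// invr_ge0 ltW.
have rho_u n : (1 <= n)%N -> rho n * u n = s^-1 * n%:R `^ (- (1 / 2)).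
  move=> n1; rewrite /rho /weight -mulrA -powRD; last by rewrite pnatr_eq0 -lt0n n1 implybT.
  by congr (_ * _ `^ _); rewrite /b; lra.
have rc : rho n @[n --> \oo] --> 0.
  by rewrite -(mulr0 s^-1); apply: cvgM; [exact: cvg_cst|exact: powRN_cvg0].
have q_cvg0 : (1 + Ex P (card_D n)) / Num.sqrt n%:R @[n --> \oo] --> (0 : R).
  rewrite (_ : (fun n => _) = (fun n => n%:R `^ (- (1 / 2)) + Ex P (card_D n) / Num.sqrt n%:R)).
    rewrite -[X in _ --> X]addr0; apply: cvgD; first exact: powRN_cvg0.
    apply: (@norm_squeeze_cvg0 _ _ (fun n =>
        fine ('N[P]_2%:E[(fun w => (card_D n w / Num.sqrt n%:R)%:E)])%E)).
      have : \forall n \near \oo, ('N[P]_2%:E[(fun w => (card_D n w / Num.sqrt n%:R)%:E)])%E \is a fin_num.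
        by move/fine_cvgP : HN => [].
      move=> hf; near=> n.
      have n1 : (1 <= n)%N by near: n; exact: nbhs_infty_gt.
      have bD : bounded_rv (card_D n) by exact: (bounded_rv_card_D HX).
      have bDn : bounded_rv (fun w => card_D n w / Num.sqrt n%:R).
        by apply: bounded_rvM => //; exact: bounded_rv_cst.
      have D0 w : 0 <= card_D n w / Num.sqrt n%:R by rewrite divr_ge0// sqrtr_ge0.
      rewrite ger0_norm ?divr_ge0 ?sqrtr_ge0 ?Ex_ge0//.
      rewrite -lee_fin fineK; last by near: n.
      have := Ex_le_Lnorm2 P bDn D0; rewrite (_ : Ex P _ = Ex P (card_D n) / Num.sqrt n%:R)//.
      by rewrite mulrC -ExZ//; congr Ex; apply/funext => w; rewrite mulrC.
    by move/fine_cvgP : HN => [].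
  by apply/funext => n; rewrite powR_Nhalf mulrDl mul1r.
apply: (cvg_in_law_normal s0 _ rho0 rc) => //.
- by lra.
- rewrite -(mulr0 s^-1).
  apply: (@cvg_trans _ (s^-1 * n%:R `^ (- (1 / 2)) @[n --> \oo])).
    by apply: near_eq_cvg; near=> n; rewrite rho_u//; near: n; exact: nbhs_infty_gt.
  by apply: cvgM; [exact: cvg_cst|exact: powRN_cvg0].
- have c0 : 0 < 1 - 2 * a by lra.
  have := sum_powR_cvg c0 => /(cvgM (@cvg_cst _ (s ^- 2) _ \oo _)).
  have -> : s ^- 2 * (1 - 2 * a)^-1 = 1.
    rewrite -exprVn exprVn s2 invrK (_ : 1 - 2 * a = 3 - 4 * p); last by ring.
    by rewrite divff// gt_eqF//; lra.
  apply: cvg_trans; apply: near_eq_cvg; apply: nearW => n.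
  rewrite /rho exprMn exprVn -mulrA; congr (_ * _).
  rewrite [RHS]mulrC -(powR_mulrn _ (powR_ge0 _ _)) -powRrM -powRN; congr (_ * _ `^ _).
    apply: eq_bigr => j _; rewrite /weight -powR_mulrn ?powR_ge0// -powRrM.
    by congr (_ `^ _); ring.
  by rewrite /b; field.
(* As [u_j / j = j^(b-1) / sqrt j], the mean error is a weighted average, with weights [j^(b-1)], of
   the null sequence [(1 + E |D_j|) / sqrt j]. The bound [b^-1 + 1] on the mass exceeds its limit
   [b^-1]. *)
- have := @toeplitz_null R (fun n => n%:R `^ (- b)) (fun j => j.+1%:R `^ (b - 1))
    (fun j => 4 * ((1 + Ex P (card_D j)) / Num.sqrt j.+1%:R)) (b^-1 + 1).
  move=> tn; have {tn} tn : n%:R `^ (- b) * (\sum_(1 <= j < n) j.+1%:R `^ (b - 1) *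
      (4 * ((1 + Ex P (card_D j)) / Num.sqrt j.+1%:R))) @[n --> \oo] --> (0 : R).
    apply: tn.
    + by move=> n; exact: powR_ge0.
    + exact: powRN_cvg0.
    + by move=> j _; exact: powR_ge0.
    + have /cvgrPdist_le /(_ 1 ltr01) := sum_powR_cvg b0; apply: filterS => n.
      by rewrite powRN mulrC ler_norml; lra.
    + rewrite -(mulr0 4); apply: cvgM; first exact: cvg_cst.
      apply: norm_squeeze_cvg0 q_cvg0; near=> n.
      have n1 : (1 <= n)%N by near: n; exact: nbhs_infty_gt.
      have q1 : 0 <= 1 + Ex P (card_D n) by rewrite addr_ge0// Ex_ge0.
      rewrite ger0_norm ?divr_ge0 ?sqrtr_ge0// ler_wpM2l//.
      by rewrite lef_pV2 ?posrE ?sqrtr_gt0 ?ltr0n// ler_wsqrtr// ler_nat.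
  apply: (@norm_squeeze_cvg0 _ _ (fun n => rho n + s^-1 * (n%:R `^ (- b) *
      (\sum_(1 <= j < n) j.+1%:R `^ (b - 1) * (4 * ((1 + Ex P (card_D j)) / Num.sqrt j.+1%:R)))))).
    near=> n; have /andP[h0 h1] := Ex_min_err_le n (rho0 n).
    rewrite ger0_norm//; apply: (le_trans h1); rewrite Ex_err_bound mulrDr mulr1 lerD2l.
    rewrite mulrA -/(rho n) ler_wpM2l//; apply: ler_sum_nat => j /andP[j1 _].
    rewrite le_eqVlt; apply/orP; left; apply/eqP.
    rewrite -powR_Nhalf /weight.
    have -> : - a = (b - 1) + (- (1 / 2)) + 1 by rewrite /b; field.
    have j0 : (j.+1%:R == 0 :> R) = false by rewrite pnatr_eq0.
    rewrite powRD ?j0 ?implybT// powRD ?j0 ?implybT//.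
    rewrite powRr1//; have {j0} : j.+1%:R != 0 :> R by rewrite j0.
    by move: (j.+1%:R) => J J0; field.
  rewrite -[X in _ --> X](addr0 0); apply: cvgD => //; rewrite -[X in _ --> X](mulr0 s^-1).
  by apply: cvgM => //; exact: cvg_cst.
move=> n w n1; rewrite /= (mulrA (rho n)) rho_u// -mulrA (mulrA s) divff ?gt_eqF//.
by rewrite powR_Nhalf mul1r mulrC.
Unshelve. all: by end_near. Qed.

Lemma critical_clt (hp : p = 3 / 4) (gamma : R) : 0 <= gamma < 1 / 2 ->
  (\forall w \ae P, (fun n => card_D n w) =O_\oo (fun n => n%:R `^ gamma : R)) ->
  cvg_in_law P (fun n => (Num.sqrt (n%:R * ln n%:R))^-1 \o* walk X n)
    (normal_prob 0 1).
Proof.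
move=> hg hO; have a2 : a = 1 / 2 by rewrite hp; lra.
(* Here [u_j^2 = 1/j], and the variance is a harmonic sum divided by [ln n]. For [n <= 1] the
   inverse of 0 makes [rho n] equal to 0. *)
pose rho (n : nat) : R := (Num.sqrt (ln n%:R))^-1.
have rho0 n : 0 <= rho n by rewrite invr_ge0 sqrtr_ge0.
have ln0 n : 0 <= ln n%:R :> R by case: n => [|n]; [rewrite ln0|rewrite ln_ge0// ler1n].
have rc : rho n @[n --> \oo] --> 0.
  apply/gtr0_cvgV0.
    near=> n; rewrite sqrtr_gt0 ln_gt0// ltr1n; near: n; exact: nbhs_infty_gt.
  apply/cvgryPge => A; near=> n.
  apply: (le_trans (ler_norm A)); rewrite -sqrtr_sqr ler_wsqrtr//.
  by near: n; move/cvgryPge : (@cvg_ln_pinfty R); apply.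
have rho_u n : rho n * u n = rho n * n%:R `^ (- (1 / 2)) by rewrite /weight a2.
apply: (cvg_in_law_normal ltr01 _ rho0 rc) => //.
- by rewrite a2.
- rewrite (funext rho_u) -[X in _ --> X](mulr0 0).
  by apply: cvgM => //; exact: powRN_cvg0.
- apply: cvg_trans (@sum_harmonic_cvg R); apply: near_eq_cvg; apply: nearW => n.
  rewrite mulrC /rho exprVn sqr_sqrtr//; congr (_ * _).
  apply: eq_bigr => j _; rewrite /weight a2 -powR_mulrn ?powR_ge0// -powRrM.
  by rewrite (_ : - (1 / 2) * 2 = -1) ?powRN ?powRr1//; field.
- apply: (@Ex_bounded_cvg0 _ _ _ _ _ 1).
  + move=> n.
    have [] // : bounded_rv (fun w => Num.min 1 (rho n * err_bound n w)).
    by apply: (history_bounded_rv HX (n := n)) => w w' /adapted_err_bound ->.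
  + move=> n w; rewrite ger0_norm ?ge_min ?lexx//.
    by rewrite le_min ler01 mulr_ge0// err_bound_ge0.
  apply: filterS hO => w hw.
  have [C hC] : exists C, forall n, err_bound n w <= C.
    by apply: (err_bound_bounded HX _ hw); rewrite a2.
  apply: (@norm_squeeze_cvg0 _ _ (fun n => rho n * C)).
    apply: nearW => n; rewrite ger0_norm; last first.
      by rewrite le_min ler01 mulr_ge0// err_bound_ge0.
    by rewrite ge_min ler_wpM2l ?orbT.
  by rewrite -(mul0r C); apply: cvgM => //; exact: cvg_cst.
move=> n w n1; rewrite /= mul1r mulrA rho_u powR_Nhalf /rho sqrtrM// mulrC.
by rewrite [_^-1 * _^-1]mulrC invfM.
Unshelve. all: by end_near. Qed.

Lemma superdiffusive_cvg (hp : 3 / 4 < p) (gamma : R) : 0 <= gamma < a ->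
  (\forall w \ae P, (fun n => card_D n w) =O_\oo (fun n => n%:R `^ gamma : R)) ->
  exists L : {RV P >-> R}, \forall w \ae P,
    (walk X n w / n%:R `^ a) @[n --> \oo] --> L w.
Proof.
move=> hg hO; have a_gt : 1 / 2 < a by lra.
have hC : \forall w \ae P, exists C, forall n, err_bound n w <= C.
  by apply: filterS hO => w; exact: (err_bound_bounded HX).
have hc := walk_cvg_ae HX p01 lambda01 a_gt hC.
have [N [mN PN hN]] := hc.
(* Set to 0 on the measurable null set [N], the sequence converges everywhere, so its limit is a
   measurable function. *)
pose h n w := (walk X n w / n%:R `^ a) * \1_(~` N) w.
have h_cvg w : cvgn (h ^~ w).
  have [Nw|Nw] := pselect (N w).
    rewrite (_ : h ^~ w = cst 0); first exact: is_cvg_cst.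
    by apply/funext => n; rewrite /h indicE memNset ?mulr0//=; exact.
  have hw : cvgn (fun n => walk X n w / n%:R `^ a).
    by apply: contrapT => /hN.
  by apply: is_cvgM => //; exact: is_cvg_cst.
pose L w := limn (h ^~ w).
have mL : measurable_fun setT L.
  apply: (@measurable_fun_cvg _ _ _ setT h L) => [n|w _].
    apply: measurable_funM; first exact: measurable_funM.
    by apply: measurable_indic; exact: measurableC.
  exact: h_cvg.
pose L' : {RV P >-> R} := HB.pack L (isMeasurableFun.Build _ _ _ _ _ mL).
exists L'; exists N; split => // w /=; apply: contra_notP => Nw.
have hE : h ^~ w = (fun n => walk X n w / n%:R `^ a).
  by apply/funext => n; rewrite /h indicE mem_set// mulr1.
by rewrite -hE; exact: h_cvg.
Qed.

End Assembly.

Theorem theorem1p7 (d : measure_display) (T : measurableType d) (R : realType)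
    (P : probability T R) (p lambda : R) (D : nat -> T -> {fset nat})
    (X Y eps : nat -> {RV P >-> R}) (I : nat -> {RV P >-> nat})
    (p01 : 0 <= p <= 1) (lambda01 : 0 <= lambda <= 1)
    (HX : TMERW P p lambda D X Y eps I)
    (HD : \forall w \ae P,
       ((#|` D n w|)%:R / n%:R : R) @[n --> \oo] --> (0 : R)) :
  (0 <= p < 3 / 4 ->
   ('N[P]_2%:E[(fun w => ((#|` D n w|)%:R / Num.sqrt n%:R)%:E)])%E
     @[n --> \oo] --> 0%E ->
   cvg_in_law P (fun n => (Num.sqrt n%:R)^-1 \o* walk X n)
     (normal_prob 0 (Num.sqrt (3 - 4 * p)^-1)))
  /\
  (p = 3 / 4 ->
   forall gamma : R, 0 <= gamma < 1 / 2 ->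
   (\forall w \ae P, (fun n => (#|` D n w|)%:R : R)
      =O_\oo (fun n => n%:R `^ gamma : R)) ->
   cvg_in_law P (fun n => (Num.sqrt (n%:R * ln n%:R))^-1 \o* walk X n)
     (normal_prob 0 1))
  /\
  (3 / 4 < p < 1 ->
   forall gamma : R, 0 <= gamma < 2 * p - 1 ->
   (\forall w \ae P, (fun n => (#|` D n w|)%:R : R)
      =O_\oo (fun n => n%:R `^ gamma : R)) ->
   exists L : {RV P >-> R}, \forall w \ae P,
     (walk X n w / n%:R `^ (2 * p - 1)) @[n --> \oo] --> L w).
Proof.
split=> [/andP[_ hp] HN|]; first exact: (diffusive_clt HX).
split=> [hp gamma hg hO|/andP[hp _] gamma hg hO].
  exact: (critical_clt HX p01 lambda01 HD hp hg hO).
exact: (superdiffusive_cvg HX p01 lambda01 hp hg hO).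
Qed.
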